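(* Under $P_N$, and also under $P_N^{(k)}$ for each $k\ge2$, the random variable $\frac{\log n}{\log N}$ (with $n\in\Omega_N$ in the case of $P_N$ and $n\in\Omega_N^{(k)}$ in the case of $P_N^{(k)}$) converges weakly, as $N\to\infty$, to the Dickman distribution.
   Context: $\{p_j\}_{j=1}^\infty$ denotes the primes in increasing order. $\Omega_N=\{n\in\mathbb{N}: p_j\nmid n \text{ for all } j>N\}$, $C_N=\sum_{n\in\Omega_N}\frac1n<\infty$, and $P_N$ is the probability measure on $\Omega_N$ given by $P_N(\{n\})=\frac1{C_N}\frac1n$, $n\in\Omega_N$. For $k\ge2$, $S_k$ denotes the set of $k$-free positive integers (those $n$ with $p^k\nmid n$ for all primes $p$), $\Omega_N^{(k)}=\Omega_N\cap S_k$, and $P_N^{(k)}(\cdot)=P_N(\,\cdot\,|S_k)$. The Dickman function $\rho$ is the unique continuous function on $(0,\infty)$ satisfying $\rho(x)=1$ for $x\in(0,1]$ and $x\rho'(x)+\rho(x-1)=0$ for $x>1$. It satisfies $\int_0^\infty\rho(x)\,dx=e^\gamma$, where $\gamma$ is Euler's constant, and the Dickman distribution is the probability distribution on $[0,\infty)$ with density $e^{-\gamma}\rho(x)$. *)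

(* Defs.v *)
From HB Require Import structures.
From mathcomp Require Import all_boot all_order all_algebra.
From mathcomp Require Import all_classical all_reals all_analysis.

Set Implicit Arguments.
Unset Strict Implicit.
Unset Printing Implicit Defensive.

Import Order.TTheory GRing.Theory Num.Theory.
Import numFieldNormedType.Exports.

Local Open Scope classical_set_scope.
Local Open Scope ring_scope.

Lemma next_prime_subproof (m : nat) : exists p, (m < p)%N && prime p.
Proof. by have [p mp pp] := prime_above m; exists p; rewrite mp. Qed.

Definition next_prime (m : nat) : nat := ex_minn (next_prime_subproof m).

(* The primes in increasing order, indexed from 1 as p_1 = 2, p_2 = 3, ...;
   the value [nth_prime 0 = 1] is junk and is never used below. *)
Definition nth_prime (j : nat) : nat := iter j next_prime 1.

Lemma next_primeP (m : nat) :
  [/\ (m < next_prime m)%N, prime (next_prime m) &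
      forall q, prime q -> (m < q)%N -> (next_prime m <= q)%N].
Proof.
rewrite /next_prime; case: ex_minnP => p /andP[mp pp] h; split => // q pq mq.
by apply: h; rewrite mq.
Qed.

Lemma nth_prime_prime (j : nat) : (0 < j)%N -> prime (nth_prime j).
Proof. by case: j => // j _; have [] := next_primeP (nth_prime j). Qed.

Lemma nth_prime_lt (j : nat) : (nth_prime j < nth_prime j.+1)%N.
Proof. by have [] := next_primeP (nth_prime j). Qed.

Lemma nth_prime_surj (q : nat) :
  prime q -> exists2 j, (0 < j)%N & nth_prime j = q.
Proof.
move=> pq.
have ge j : (j <= nth_prime j)%N.
  by elim: j => // j IH; exact: leq_ltn_trans IH (nth_prime_lt j).
have ex : exists j, (q <= nth_prime j)%N by exists q.
case: (ex_minnP ex) => -[|j] qj jmin.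
  by have := leq_trans (prime_gt1 pq) qj.
exists j.+1 => //; apply/eqP; rewrite eqn_leq qj andbT.
have [_ _] := next_primeP (nth_prime j); apply => //.
by rewrite ltnNge; apply/negP => /jmin; rewrite ltnn.
Qed.

Definition Omega (N : nat) : set nat :=
  [set n | (0 < n)%N /\ forall j, (N < j)%N -> ~~ (nth_prime j %| n)%N].

Definition kfree (k : nat) : set nat :=
  [set n | (0 < n)%N /\ forall p, prime p -> ~~ (p ^ k %| n)%N].

Section natural_probability.
Context (R : realType) (N : nat).
Local Open Scope ereal_scope.

Definition C_ : R := fine (\esum_(n in Omega N) (n%:R^-1)%:E).

Definition P_pmf (n : nat) : R :=
  if n \in Omega N then (C_^-1 * n%:R^-1)%R else 0%R.

Definition P_ (A : set nat) : \bar R := \esum_(n in A) (P_pmf n)%:E.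

End natural_probability.

Section harmonic_sum_finite.
Context (R : realType).

Let S (N M : nat) : R := \sum_(0 <= n < M | n \in Omega N) n%:R^-1.

Let S0 M : S 0 M <= 1.
Proof.
have O1 n : n \in Omega 0 -> n = 1%N.
  rewrite inE => -[n0 h]; apply/eqP; case: (eqVneq n 1%N) => // n1.
  have n2 : (1 < n)%N by rewrite ltn_neqAle eq_sym n1.
  have [j j0 jE] := nth_prime_surj (pdiv_prime n2).
  by have := h j j0; rewrite jE pdiv_dvd.
rewrite /S; elim: M => [|M IH]; first by rewrite big_geq.
rewrite big_mkcond big_nat_recr//= -big_mkcond/=.
case: ifPn => [/O1 M1|_]; last by rewrite addr0.
rewrite M1 invr1 big_mkcond big_nat1.
by case: ifPn => [/O1//|_]; rewrite add0r.
Qed.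

Let sum_dvd (p : nat) (g : nat -> R) K : (0 < p)%N ->
  \sum_(0 <= n < p * K | (p %| n)%N) g n = \sum_(0 <= m < K) g (p * m)%N.
Proof.
move=> p0; elim: K => [|K IH]; first by rewrite muln0 !big_geq.
rewrite mulnS addnC big_mkcond (@big_cat_nat _ _ _ (p * K))//= ?leq_addr//.
rewrite -big_mkcond IH big_nat_recr//=; congr +%R.
rewrite big_ltn ?dvdn_mulr//; last by rewrite -[ltnLHS]addn0 ltn_add2l.
rewrite big1_seq ?addr0// => n /andP[_]; rewrite mem_index_iota => /andP[h1 h2].
case: ifPn => // /dvdnP[m nE]; exfalso; move: h1 h2; rewrite nE.
rewrite addnC -mulnS [(m * p)%N]mulnC !ltn_pmul2l// ltnS => h1.
by move=> /(leq_trans h1); rewrite ltnn.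
Qed.

Let S_step N M : S N.+1 M <= 2 * S N M.
Proof.
set p := nth_prime N.+1; have pp : prime p by exact: nth_prime_prime.
have p2 : (1 < p)%N by exact: prime_gt1.
have p0 : (0 < p)%N by exact: prime_gt0.
have inv0 n : 0 <= n%:R^-1 :> R by rewrite invr_ge0.
have E : S N.+1 M <= 2^-1 * S N.+1 M + S N M.
  rewrite {1}/S (bigID (fun n => p %| n)%N)/=; apply: lerD.
    pose g n : R := if n \in Omega N.+1 then n%:R^-1 else 0.
    have g0 n : 0 <= g n by rewrite /g; case: ifP.
    apply: (@le_trans _ _ (\sum_(0 <= n < p * M | (p %| n)%N) g n)).
      rewrite [leRHS]big_mkcond (@big_cat_nat _ _ _ M)//= ?leq_pmull//.
      rewrite -[leLHS]addr0; apply: lerD; last first.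
        by apply: sumr_ge0 => n _; case: ifP.
      rewrite [leLHS]big_mkcond; apply: ler_sum => n _; rewrite /g.
      by rewrite andbC; case: (p %| n)%N => /=; case: (n \in Omega N.+1).
    rewrite sum_dvd// /S mulr_sumr [leRHS]big_mkcond/=.
    apply: ler_sum => m _; rewrite /g.
    case: ifPn => [|_]; last by case: ifP => // _; rewrite mulr_ge0.
    rewrite inE => -[]; rewrite muln_gt0 => /andP[_ m0] h.
    rewrite ifT; last first.
      rewrite inE; split => // j Nj; apply: contra (h j Nj) => jm.
      exact: dvdn_mull.
    rewrite natrM invfM ler_wpM2r// lef_pV2 ?posrE ?ltr0n//.
    by rewrite ler_nat.
  rewrite /S big_mkcond [leRHS]big_mkcond/=; apply: ler_sum => n _.
  case: ifPn => [|_]; last by case: ifP.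
  move=> /andP[+ pn]; rewrite inE => -[n0 h]; rewrite ifT// inE; split=> // j.
  by rewrite leq_eqVlt => /predU1P[<-//|]; exact: h.
have -> : S N.+1 M = 2 * (S N.+1 M - 2^-1 * S N.+1 M).
  by rewrite mulrBr mulrA divff ?pnatr_eq0// mul1r mulr_natl mulr2n addrK.
by rewrite ler_pM2l// lerBlDl.
Qed.

Lemma esum_Omega_lty (N : nat) :
  (\esum_(n in Omega N) (n%:R^-1 : R)%:E < +oo)%E.
Proof.
have SN M : S N M <= 2 ^+ N.
  elim: N => [|n IH]; first by rewrite expr0 S0.
  by rewrite exprS (le_trans (S_step n M))// ler_pM2l.
apply: (@le_lt_trans _ _ (2 ^+ N)%:E); last exact: ltry.
rewrite -(set_mem_set (Omega N)) -nneseries_esum; last first.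
  by move=> n _; rewrite lee_fin invr_ge0.
apply: lime_le.
  by apply: is_cvg_nneseries => n _ _; rewrite lee_fin invr_ge0.
by apply: nearW => M; rewrite sumEFin lee_fin; exact: SN.
Qed.

End harmonic_sum_finite.

Lemma Omega1 (N : nat) : Omega N 1%N.
Proof.
split=> // j Nj; rewrite dvdn1 gtn_eqF// prime_gt1// nth_prime_prime//.
exact: leq_ltn_trans Nj.
Qed.

Section natural_probability_instance.
Context (R : realType) (N : nat).
Local Open Scope ereal_scope.

Local Notation C := (C_ R N).
Local Notation P := (@P_ R N).

Lemma C_E : C%:E = \esum_(n in Omega N) (n%:R^-1)%:E.
Proof.
rewrite fineK// ge0_fin_numE ?esum_Omega_lty//.
by apply: esum_ge0 => n _; rewrite lee_fin invr_ge0.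
Qed.

Lemma C_gt0 : (0 < C)%R.
Proof.
rewrite -lte_fin C_E; apply: (@lt_le_trans _ _ 1) => //.
apply: esum_ge; exists [set 1%N]; first by split=> // _ ->; exact: Omega1.
by rewrite fsbig_set1 invr1.
Qed.

Lemma P_pmf_ge0 n : (0 <= P_pmf R N n)%R.
Proof.
rewrite /P_pmf; case: ifP => // _.
by rewrite mulr_ge0// invr_ge0// ltW// C_gt0.
Qed.

Let P0 : P set0 = 0. Proof. exact: esum_set0. Qed.

Let P_ge0 A : 0 <= P A.
Proof. by apply: esum_ge0 => n _; rewrite lee_fin P_pmf_ge0. Qed.

Let P_sigma_additive : semi_sigma_additive P.
Proof.
move=> F mF tF mUF; apply: cvg_toP.
  apply: ereal_nondecreasing_is_cvgn => a b ab.
  by apply: lee_sum_nneg_natr => // n _ _; exact: P_ge0.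
by rewrite /P_ nneseries_sum_bigcup// => i; rewrite lee_fin P_pmf_ge0.
Qed.

HB.instance Definition _ :=
  isMeasure.Build _ _ _ P P0 P_ge0 P_sigma_additive.

Let P_setT : P [set: nat] = 1.
Proof.
rewrite /P_ -nneseries_esumT; last by move=> n; rewrite lee_fin P_pmf_ge0.
pose w n : \bar R := (if n \in Omega N then n%:R^-1 else 0)%:E.
have w0 n : 0 <= w n by rewrite /w lee_fin; case: ifP; rewrite ?invr_ge0.
rewrite (eq_eseriesr (g := fun n => C^-1%:E * w n)); last first.
  by move=> n _; rewrite /P_pmf /w -EFinM; case: ifP => // _; rewrite mulr0.
rewrite nneseriesZl// nneseries_esumT//.
suff -> : \esum_(n in [set: nat]) w n = C%:E.
  by rewrite -EFinM mulVf// gt_eqF// C_gt0.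
rewrite C_E [RHS]esum_mkcond; apply: eq_esum => n _.
by rewrite /w; case: ifP.
Qed.

HB.instance Definition _ := Measure_isProbability.Build _ _ R P P_setT.

Lemma P_set1 n : Omega N n -> P [set n] = (C^-1 * n%:R^-1)%:E.
Proof.
by move=> On; rewrite /P_ esum_set1 ?lee_fin ?P_pmf_ge0// /P_pmf mem_set.
Qed.

End natural_probability_instance.

Lemma measurable_kfree (k : nat) : measurable (kfree k).
Proof. by []. Qed.

(* [mnormalize mu P] divides [mu] by its total mass, and would only fall back
   on [P] if that mass were [0] or [+oo]; see [Pk_E]. *)
Definition Pk_ (R : realType) (k N : nat) : set nat -> \bar R :=
  mnormalize (mrestr (@P_ R N) (measurable_kfree k)) (@P_ R N).

HB.instance Definition _ (R : realType) (k N : nat) :=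
  Probability.copy (@Pk_ R k N)
    (mnormalize (mrestr (@P_ R N) (measurable_kfree k)) (@P_ R N)).

Lemma Pk_E (R : realType) (k N : nat) (A : set nat) : (0 < k)%N ->
  @Pk_ R k N A =
  (P_ R N (A `&` kfree k) * ((fine (P_ R N (kfree k)))^-1)%:E)%E.
Proof.
move=> k0; rewrite /Pk_ /mnormalize/= /mrestr setTI ifF//.
have k1 : kfree k 1%N.
  split=> // p pp; rewrite dvdn1 gtn_eqF//.
  by rewrite -(exp1n k) ltn_exp2r// prime_gt1.
apply/negbTE; rewrite negb_or; apply/andP; split; last first.
  by rewrite -ltey (le_lt_trans (probability_le1 _ _))// ltry.
rewrite gt_eqF// (@lt_le_trans _ _ (P_ R N [set 1%N]))//.
  rewrite P_set1; last exact: Omega1.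
  by rewrite lte_fin invr1 mulr1 invr_gt0 C_gt0.
by apply: le_measure; rewrite ?inE// => _ ->.
Qed.

Definition log_ratio (R : realType) (N n : nat) : R := ln n%:R / ln N%:R.

HB.instance Definition _ (R : realType) (N : nat) :=
  @isMeasurableFun.Build _ _ nat R (@log_ratio R N) (fun _ _ _ => I).

Definition weak_cvg (R : realType)
    (mu_ : nat -> probability R R) (mu : probability R R) : Prop :=
  forall f : R -> R, continuous f -> bounded_fun f ->
    (\int[mu_ N]_x (f x)%:E)%E @[N --> \oo] --> (\int[mu]_x (f x)%:E)%E.

(* [rho] is a total function on [R]; its values on ]-oo, 0] are left
   unconstrained and are not used by [dickman_distribution]. *)
Definition dickman_function (R : realType) (rho : R -> R) : Prop :=
  [/\ {within `]0, +oo[, continuous rho},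
      forall x : R, 0 < x <= 1 -> rho x = 1 &
      forall x : R, 1 < x ->
        derivable rho x 1 /\ x * derive1 rho x + rho (x - 1) = 0].

Definition euler_gamma (R : realType) : R :=
  limn (fun n => series harmonic n - ln n%:R).

Definition dickman_distribution (R : realType) (D : probability R R) : Prop :=
  exists2 rho : R -> R, dickman_function rho &
    forall A : set R, measurable A ->
      D A = (\int[lebesgue_measure]_(x in A `&` `]0%R, +oo[)
               (expR (- euler_gamma R) * rho x)%:E)%E.

(* Main.v *)
Require Import Defs.
From HB Require Import structures.
From mathcomp Require Import all_boot all_order all_algebra.
From mathcomp Require Import all_classical all_reals all_analysis.
From mathcomp Require Import measurable_realfun.
From mathcomp Require Import ring lra.

(** A random variable [X >= 0] has the Dickman distribution when biasing its law
    by [X] amounts to adding an independent uniform variable [U] of the unit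
    interval: [E (X * f X) = E (f (X + U))]. With [f x = x ^ k] this gives a
    recursion for the moments, [E (X ^ k.+1) = E ((X + U) ^ k)], which determines
    all of them ([dickman_moments]). The proof shows that [log n / log N] satisfies
    this recursion in the limit, and that the moments determine the limit law.

    On the arithmetic side, let [n] have mass proportional to [1 / n] on a set of
    integers with prime factors among the first [N] primes. Writing [ln n] as the
    sum of [ln q] over the prime powers [q ^ a] dividing [n], and [n = q ^ a * m],
    one finds that biasing by [ln n] replaces [n] by [q * m], where [m] has the
    original law and the prime [q] has mass proportional to [ln q / q]; the higher
    powers, and the [m] already divisible by [q], for which [q * m] may not be
    k-free, carry an extra factor [1 / q] ([moment_size_bias]). One argument thus covers [P_N] and its
    conditionings: it uses that the support contains the divisors of its elements
    and their products with new primes ([prime_extensible]).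

    It remains that [ln q / ln N] becomes uniform under the masses
    [ln q / (q * ln N)] ([prime_weight_moment_asympt]). This follows from Legendre's
    formula for factorials, which gives, to leading order, both Mertens' theorem on
    the sum of [ln q / q] and the asymptotics [ln q ~ ln N] for the [N]-th prime
    [q]; weighted Cesaro means do the rest.

    For the Dickman function, the delay equation integrates to
    [x * rho x = integral of rho over (x - 1, x)], from which [rho >= 0] follows,
    and Tonelli's theorem turns it into the same recursion
    ([dickman_distribution_moments]).

    Finally, the recursion makes the moments grow more slowly than [k! / s ^ k] for
    every [s], so that convergence of moments implies convergence of Laplace
    transforms by Taylor expansion, and then of the integrals of bounded continuous
    functions, by Bernstein approximation in the variable [exp (- d * x)]
    ([weak_cvg_of_moments]). *)

Set Implicit Arguments.
Unset Strict Implicit.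
Unset Printing Implicit Defensive.

Import Order.TTheory GRing.Theory Num.Theory.
Import numFieldNormedType.Exports.

Local Open Scope classical_set_scope.
Local Open Scope ring_scope.

(** * Primes and factorials *)

Arguments nth_prime : simpl never.

Lemma ltn_nth_prime : {homo nth_prime : i j / (i < j)%N}.
Proof. by apply: homo_ltn; [exact: ltn_trans | exact: nth_prime_lt]. Qed.

Lemma nth_prime_inj : injective nth_prime.
Proof.
move=> i j; case: (ltngtP i j) => // /ltn_nth_prime h e.
  by rewrite e ltnn in h.
by rewrite e ltnn in h.
Qed.

Lemma ltn_id_nth_prime j : (j < nth_prime j)%N.
Proof. by elim: j => // j IH; exact: leq_ltn_trans IH (nth_prime_lt j). Qed.

Section prime_factorization.
Variable R : realType.

Lemma ln_natE (n : nat) : (0 < n)%N ->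
  ln n%:R = \sum_(q <- primes n) (logn q n)%:R * ln q%:R :> R.
Proof.
move=> n0; rewrite {1}(prod_prime_decomp n0) prime_decompE big_map /=.
have : all (fun q => 0 < q)%N (primes n).
  by apply/allP => q; rewrite mem_primes => /andP[/prime_gt0].
elim: (primes n) => [|q s IH] /=; first by rewrite !big_nil ln1.
move=> /andP[q0 s0]; rewrite !big_cons natrM lnM ?posrE ?ltr0n ?expn_gt0 ?q0//.
  by rewrite natrX lnXn ?ltr0n// IH// mulr_natl.
rewrite big_seq_cond big_mkcond prodn_gt0// => i.
by rewrite andbT; case: ifP => // /(allP s0) i0; rewrite expn_gt0 i0.
Qed.

(** Indexed by the prime divisors of [n], a sum over the first [N] primes is a
    partial sum of [ln n]: it is at most [ln n], and it is all of [ln n] when no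
    larger prime divides [n]. *)
Lemma sum_logn_first_primes (N n : nat) :
  \sum_(i < N) (logn (nth_prime i.+1) n)%:R * ln (nth_prime i.+1)%:R =
  \sum_(q <- primes n | q \in [seq nth_prime i.+1 | i <- iota 0 N])
     (logn q n)%:R * ln q%:R :> R.
Proof.
set s := map _ _.
have us : uniq s.
  rewrite map_inj_uniq ?iota_uniq// => i j /nth_prime_inj [] //.
have -> : \sum_(i < N) (logn (nth_prime i.+1) n)%:R * ln (nth_prime i.+1)%:R =
   \sum_(q <- s) (logn q n)%:R * ln q%:R :> R.
  rewrite big_map -(big_mkord xpredT (fun i =>
    (logn (nth_prime i.+1) n)%:R * ln (nth_prime i.+1)%:R)).
  by rewrite /index_iota subn0.
rewrite (bigID (mem (primes n))) /= addrC big1 ?add0r; last first.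
  move=> q qn; rewrite (_ : logn q n = 0%N) ?mul0r//.
  by apply/eqP; rewrite -leqn0 leqNgt logn_gt0.
rewrite -big_filter -[RHS]big_filter; apply: perm_big.
apply: uniq_perm; rewrite ?filter_uniq ?primes_uniq// => q.
by rewrite !mem_filter andbC.
Qed.

Lemma sum_logn_first_primes_le (N n : nat) : (0 < n)%N ->
  \sum_(i < N) (logn (nth_prime i.+1) n)%:R * ln (nth_prime i.+1)%:R
    <= ln n%:R :> R.
Proof.
move=> n0; rewrite sum_logn_first_primes ln_natE// [leRHS](bigID (mem
  [seq nth_prime i.+1 | i <- iota 0 N]))/= lerDl big_seq_cond sumr_ge0// => q.
rewrite mem_primes => /andP[/and3P[q0 _ _] _].
by rewrite mulr_ge0// ln_ge0// ler1n prime_gt0.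
Qed.

Lemma sum_logn_first_primes_eq (N n : nat) : (0 < n)%N ->
    (forall q, prime q -> (q %| n)%N -> exists2 i, (i < N)%N & nth_prime i.+1 = q) ->
  \sum_(i < N) (logn (nth_prime i.+1) n)%:R * ln (nth_prime i.+1)%:R
    = ln n%:R :> R.
Proof.
move=> n0 h; rewrite sum_logn_first_primes ln_natE// [RHS]big_seq.
rewrite [LHS]big_seq_cond; apply: eq_bigl => q; case: (boolP (q \in primes n)) => //.
rewrite mem_primes => /and3P[qp _ qn]; have [i iN <-] := h q qp qn.
by rewrite (map_f (fun i => nth_prime i.+1)) ?mem_iota.
Qed.

Lemma ln_fact_le (n : nat) : ln (n`!)%:R <= n%:R * ln n%:R :> R.
Proof.
have [->|n0] := posnP n; first by rewrite fact0 ln1 mul0r.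
rewrite mulr_natl -lnXn ?ltr0n// -natrX ler_ln ?posrE ?ltr0n ?fact_gt0 ?expn_gt0 ?n0//.
rewrite ler_nat fact_prod big_add1 big_mkord /= -[n in (n ^ _)%N]/(id n).
rewrite -[X in (_ ^ X)%N](card_ord n) -prod_nat_const.
by apply: leq_prod => i _.
Qed.

(** [n ^ n / n!] is one term of the series of [exp n]. *)
Lemma ln_fact_ge (n : nat) : n%:R * ln n%:R - n%:R <= ln (n`!)%:R :> R.
Proof.
case: n => [|n]; first by rewrite fact0 ln1 mul0r subr0.
have n0 : 0 < n.+1%:R :> R by rewrite ltr0n.
have f0 : 0 < (n.+1)`!%:R :> R by rewrite ltr0n fact_gt0.
have h : n.+1%:R ^+ n.+1 <= expR n.+1%:R * (n.+1)`!%:R :> R.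
  rewrite -ler_pdivrMr// (le_trans _ (expR_ge1Dxn n (ltW n0)))//.
  by rewrite lerDr ler01.
move: h; rewrite -ler_ln ?posrE ?exprn_gt0// ?mulr_gt0 ?expR_gt0//.
rewrite lnM ?posrE ?expR_gt0// expRK lnXn// mulr_natl.
by rewrite lerBlDl.
Qed.

(** Legendre's formula for [n!] with the multiples of each prime [q] only: there
    are at least [n / q - 1] of them. The parameter [n] is free; taken as a large
    multiple of [N], it makes the last term small relative to [ln N]. *)
Lemma sum_ln_div_prime_le (N n : nat) : (0 < n)%N ->
  \sum_(i < N) ln (nth_prime i.+1)%:R / (nth_prime i.+1)%:R <=
  ln n%:R + (\sum_(i < N) ln (nth_prime i.+1)%:R) / n%:R :> R.
Proof.
move=> n0; have n0' : 0 < n%:R :> R by rewrite ltr0n.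
rewrite -(ler_pM2r n0') mulrDl divfK ?gt_eqF// -lerBlDr [_ * n%:R]mulrC.
apply: le_trans (le_trans (sum_logn_first_primes_le N (fact_gt0 n)) _); last first.
  by rewrite mulrC; apply: le_trans (ln_fact_le n) _; rewrite mulrC.
rewrite mulr_sumr -sumrB; apply: ler_sum => i _.
set p := nth_prime i.+1; have pp : prime p by exact: nth_prime_prime.
have p0 : 0 < p%:R :> R by rewrite ltr0n prime_gt0.
rewrite mulrCA -[X in _ - X]mulr1 -mulrBr [leRHS]mulrC ler_wpM2l//.
  by rewrite ln_ge0// ler1n prime_gt0.
rewrite logn_fact// big_ltn// expn1 natrD.
apply: (@le_trans _ _ (n %/ p)%:R); last by rewrite lerDl.
rewrite lerBlDr ler_pdivrMr// natr1 -natrM ler_nat ltnW//.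
exact: ltn_ceil (prime_gt0 pp).
Qed.

(** Legendre's formula for the factorial of the [N]-th prime: only the first [N]
    primes divide it, and all multiples of their powers amount to at most
    [n / (q - 1)] factors [q]. *)
Lemma ln_nth_prime_le (N : nat) : (0 < N)%N ->
  ln (nth_prime N)%:R - 1 <=
  \sum_(i < N) ln (nth_prime i.+1)%:R / (nth_prime i.+1).-1%:R :> R.
Proof.
move=> N0; set n := nth_prime N.
have n0 : (0 < n)%N by rewrite prime_gt0// nth_prime_prime.
have n0' : 0 < n%:R :> R by rewrite ltr0n.
rewrite -(ler_pM2l n0') mulrBr mulr1; apply: le_trans (ln_fact_ge n) _.
rewrite -(@sum_logn_first_primes_eq N) ?fact_gt0//; last first.
  move=> q qp; rewrite fact_prod big_add1 /= big_mkord.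
  rewrite Euclid_dvd_prod// big_has => /hasP[/= k _ qk].
  have qn : (q <= n)%N by rewrite (leq_trans (dvdn_leq _ qk)).
  have [[//|j] _ qE] := nth_prime_surj qp; exists j => //.
  by move: qn; rewrite -qE leqNgt; apply: contraNT; rewrite -ltnNge => /ltn_nth_prime.
rewrite mulr_sumr; apply: ler_sum => i _.
set p := nth_prime i.+1; have pp : prime p by exact: nth_prime_prime.
have p1 : 0 < p.-1%:R :> R by rewrite ltr0n -subn1 subn_gt0 prime_gt1.
have p0 : 0 < p%:R :> R by rewrite ltr0n prime_gt0.
have pE : p%:R = p.-1%:R + 1 :> R by rewrite natr1 prednK// prime_gt0.
rewrite mulrCA [leLHS]mulrC ler_wpM2l//; first by rewrite ln_ge0// ler1n prime_gt0.
rewrite logn_fact//.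
(* the truncated geometric series, with a remainder that telescopes *)
have H m : (\sum_(1 <= k < m.+1) n %/ p ^ k)%:R <=
    n%:R / p.-1%:R * (1 - p%:R^-1 ^+ m) :> R.
  elim: m => [|m IH]; first by rewrite big_geq// expr0 subrr mulr0.
  rewrite big_nat_recr//= natrD; apply: le_trans (lerD IH (lexx _)) _.
  apply: (@le_trans _ _ (n%:R / p.-1%:R * (1 - p%:R^-1 ^+ m) + n%:R * p%:R^-1 ^+ m.+1)).
    rewrite lerD2l exprVn ler_pdivlMr ?exprn_gt0//.
    by rewrite -natrX -natrM ler_nat leq_trunc_div.
  rewrite [leLHS](_ : _ = n%:R / p.-1%:R * (1 - p%:R^-1 ^+ m.+1))// exprS pE.
  by move: p1; set c := p.-1%:R; set z := _ ^+ m => p1; field; apply/andP; split; lra.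
rewrite (le_trans (H n))// ler_piMr ?divr_ge0 ?ltW//.
by rewrite ltrBlDr ltrDl exprn_gt0// invr_gt0.
Qed.

End prime_factorization.

(** * Asymptotics of weighted sums over the primes *)

Section asymptotics.
Variable R : realType.

Lemma cvg_finite_sum (I : Type) (r : seq I) (f : I -> R^nat) (l : I -> R) :
    (forall i, f i n @[n --> \oo] --> l i) ->
  \sum_(i <- r) f i n @[n --> \oo] --> \sum_(i <- r) l i.
Proof.
move=> fl; elim: r => [|i r IH].
  by rewrite big_nil; under eq_fun do rewrite big_nil; exact: cvg_cst.
rewrite big_cons; under eq_fun do rewrite big_cons.
exact: cvgD.
Qed.

Lemma cvgn_mul (u v : R^nat) (l m : R) : u @ \oo --> l -> v @ \oo --> m ->
  u n * v n @[n --> \oo] --> l * m.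
Proof. exact: cvgM. Qed.

Lemma cvgn_exp (u : R^nat) (l : R) k : u @ \oo --> l ->
  u n ^+ k @[n --> \oo] --> l ^+ k.
Proof.
move=> ul; elim: k => [|k IH]; first by under eq_fun do rewrite expr0; exact: cvg_cst.
by rewrite exprS; under eq_fun do rewrite exprS; exact: cvgn_mul.
Qed.

Lemma cvgn_div (u v : R^nat) (l m : R) : u @ \oo --> l -> v @ \oo --> m ->
  m != 0 -> u n / v n @[n --> \oo] --> l / m.
Proof. by move=> ul vm m0; apply: cvgM => //; exact: cvgV. Qed.

(** The terms before the index from which c is close to l contribute a
    constant, negligible against the diverging total weight. *)
Lemma weighted_cesaro (b c : R^nat) (l : R) :
    (forall n, 0 <= b n) -> (\sum_(i < n) b i @[n --> \oo] --> +oo) ->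
    c @ \oo --> l ->
  (\sum_(i < n) b i * c i) / (\sum_(i < n) b i) @[n --> \oo] --> l.
Proof.
move=> b0 bo cl; apply/cvgrPdist_le => e e0.
have e2 : 0 < e / 2 by rewrite divr_gt0.
have [K _ HK] : \forall n \near \oo, `|l - c n| <= e / 2.
  by move/cvgrPdist_le : cl => /(_ _ e2).
pose H := \sum_(i < K) b i * `|l - c i|.
have H0 : 0 <= H by apply: sumr_ge0 => i _; rewrite mulr_ge0.
near=> n.
have Kn : (K <= n)%N by near: n; exact: nbhs_infty_ge.
have Sbig : 1 + H / (e / 2) < \sum_(i < n) b i.
  by near: n; move/cvgryPgt : bo; exact.
set S := \sum_(i < n) b i in Sbig *.
have S0 : 0 < S by rewrite (le_lt_trans _ Sbig)// addr_ge0// divr_ge0// ltW.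
have -> : l - (\sum_(i < n) b i * c i) / S = (\sum_(i < n) b i * (l - c i)) / S.
  have -> : \sum_(i < n) b i * (l - c i) = S * l - \sum_(i < n) b i * c i.
    by rewrite mulr_suml -sumrB; apply: eq_bigr => i _; rewrite mulrBr.
  by rewrite mulrBl (mulrC S) mulfK// gt_eqF.
rewrite normrM normfV (gtr0_norm S0) ler_pdivrMr//.
apply: (@le_trans _ _ (H + e / 2 * S)); last first.
  have : H <= e / 2 * S.
    rewrite mulrC -ler_pdivrMr// ltW// (le_lt_trans _ Sbig)// lerDr//.
  by rewrite [e in e * S]splitr mulrDl; lra.
apply: le_trans (ler_norm_sum _ _ _) _.
pose F i := b i * `|l - c i|.
have -> : \sum_(i < n) `|b i * (l - c i)| = \sum_(0 <= i < n) F i.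
  by rewrite big_mkord; apply: eq_bigr => i _; rewrite normrM ger0_norm.
rewrite (big_cat_nat (n := K))//= big_mkord; apply: lerD => //.
rewrite /S -(big_mkord xpredT b) (big_cat_nat (n := K) (F := b))//= mulrDr.
rewrite -[leLHS]add0r; apply: lerD.
  by apply: mulr_ge0; [exact: ltW | exact: sumr_ge0].
rewrite mulr_sumr big_nat_cond [leRHS]big_nat_cond.
apply: ler_sum => i /andP[/andP[Ki _] _].
by rewrite /F mulrC ler_wpM2r//; exact: HK.
Unshelve. all: by end_near. Qed.

Definition prime_weight (i : nat) : R :=
  ln (nth_prime i.+1)%:R / (nth_prime i.+1)%:R.

Local Notation a := prime_weight.
Local Notation A n := (\sum_(i < n) a i).
Local Notation p i := ((nth_prime i.+1)%:R : R).

Lemma nth_primeS_gt1 i : 1 < p i.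
Proof. by rewrite ltr1n prime_gt1// nth_prime_prime. Qed.

Lemma ln_nth_primeS_gt0 i : 0 < ln (p i).
Proof. by rewrite ln_gt0// nth_primeS_gt1. Qed.

Lemma prime_weight_gt0 i : 0 < a i.
Proof.
by rewrite divr_gt0 ?ln_nth_primeS_gt0// (lt_trans ltr01)// nth_primeS_gt1.
Qed.

Lemma cvg_inv_nth_prime : (p i)^-1 @[i --> \oo] --> 0.
Proof.
apply: (@squeeze_cvgr _ _ _ _ (cst 0) (@harmonic R)); last 2 first.
- exact: cvg_cst.
- exact: cvg_harmonic.
apply: nearW => i; rewrite /cst invr_ge0 ler0n /= /harmonic.
rewrite lef_pV2 ?posrE ?ltr0n// ?prime_gt0 ?nth_prime_prime// ler_nat.
by rewrite ltnW// ltn_id_nth_prime.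
Qed.

Lemma ln_nat_cvgy : (ln n%:R : R) @[n --> \oo] --> +oo.
Proof.
apply/cvgryPge => M; near=> n.
have n0 : 0 < n%:R :> R by rewrite ltr0n; near: n; exact: nbhs_infty_gt.
rewrite -(expRK M) ler_ln ?posrE ?expR_gt0//.
by near: n; exact: nbhs_infty_ger.
Unshelve. all: by end_near. Qed.

Local Notation B n := (\sum_(i < n) ln (p i) / (nth_prime i.+1).-1%:R).

Let pred_prime i : (nth_prime i.+1).-1%:R = p i - 1.
Proof. by rewrite -subn1 natrB// prime_gt0// nth_prime_prime. Qed.

Let le_ln_nth_prime N : ln N%:R <= ln (nth_prime N)%:R :> R.
Proof.
have [->|N0] := posnP N; first by rewrite ln0// ln_ge0// ler1n.
have Np := ltn_id_nth_prime N.
by rewrite ler_ln ?posrE ?ltr0n ?(leq_trans _ Np)// ler_nat ltnW.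
Qed.

(** The sums of [ln q / (q - 1)] are at least [ln N - 1], and
    [1 / (q - 1) <= 2 / q]. *)
Lemma sum_prime_weight_cvgy : A n @[n --> \oo] --> +oo.
Proof.
apply/cvgryPge => M; near=> n.
have n0 : (0 < n)%N by near: n; exact: nbhs_infty_gt.
have h1 : 2 * M + 1 <= ln n%:R by near: n; move/cvgryPge: ln_nat_cvgy; exact.
have h2 := @ln_nth_prime_le R n n0.
have h3 := le_ln_nth_prime n.
suff : B n <= 2 * A n by lra.
rewrite mulr_sumr; apply: ler_sum => i _; rewrite pred_prime /a.
have := nth_primeS_gt1 i; have := ln_nth_primeS_gt0 i.
have : 2 <= p i by rewrite ler_nat prime_gt1// nth_prime_prime.
move: (p i) => x x2 lx x1.
have x0 : 0 < x by lra.
have x10 : 0 < x - 1 by lra.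
by rewrite mulrCA ler_pM2l// ler_pdivlMr// mulrC ler_pdivrMr//; lra.
Unshelve. all: by end_near. Qed.

Lemma sum_prime_weight_gt0 N : (0 < N)%N -> 0 < A N.
Proof.
case: N => // N _; rewrite big_ord_recr/= ltr_wpDl ?prime_weight_gt0//.
by apply: sumr_ge0 => i _; rewrite ltW// prime_weight_gt0.
Qed.

Let cvg_B_A : B n / A n @[n --> \oo] --> (1 : R).
Proof.
have c1 : p i / (p i - 1) @[i --> \oo] --> (1 : R).
  have -> : (fun i => p i / (p i - 1)) = (fun i => (1 - (p i)^-1)^-1).
    apply/funext => i; have := nth_primeS_gt1 i; move: (p i) => x x1.
    by field; lra.
  rewrite -[X in _ --> X]invr1; apply: cvgV => //.
  rewrite -[X in _ --> X](subr0 1); apply: cvgB; first exact: cvg_cst.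
  exact: cvg_inv_nth_prime.
have := weighted_cesaro (fun i => ltW (prime_weight_gt0 i)) sum_prime_weight_cvgy c1.
apply: cvg_trans; apply: near_eq_cvg; apply: nearW => n /=.
congr (_ / _); apply: eq_bigr => i _; rewrite pred_prime /a.
by have := nth_primeS_gt1 i; move: (p i) (ln _) => x y x1; field; lra.
Qed.

Let A_le N m : (0 < N)%N -> (0 < m)%N ->
  A N <= ln N%:R + ln m%:R + ln (nth_prime N)%:R / m%:R.
Proof.
move=> N0 m0; have Nm0 : (0 < N * m)%N by rewrite muln_gt0 N0.
apply: le_trans (sum_ln_div_prime_le R N Nm0) _.
rewrite natrM lnM ?posrE ?ltr0n// lerD2l.
rewrite ler_pdivrMr ?mulr_gt0 ?ltr0n// [X in _ * X]mulrC mulrA divfK ?pnatr_eq0 -?lt0n//.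
rewrite mulrC -[N in N%:R * _]card_ord mulr_natl -sumr_const.
apply: ler_sum => i _; rewrite ler_ln ?posrE ?ltr0n ?prime_gt0 ?nth_prime_prime//.
rewrite ler_nat; have := ltn_ord i; rewrite leq_eqVlt => /predU1P[->//|].
by move/ltn_nth_prime/ltnW.
Qed.

(** Write [q] for the [N]-th prime and [A] for the sum of the weights. The
    factorial of [q] gives [ln q <= (1 + o(1)) * A], and that of [N * m] gives
    [A <= ln N + ln m + ln q / m]. Since [ln N <= ln q], the two bounds together
    with a large [m] force both ratios to [1]. *)
Let ratio_asympt (e : R) : 0 < e -> \forall N \near \oo,
  `|1 - ln (nth_prime N)%:R / ln N%:R| <= e /\ `|1 - A N / ln N%:R| <= e.
Proof.
(* every error term below is at most [6 * d * ln N]; the bound [1 / 16] on [d]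
   is what first gives [ln q <= 2 * ln N] *)
move=> e0; pose d := Num.min (e / 16) (16^-1).
have d0 : 0 < d by rewrite lt_min divr_gt0//= invr_gt0.
have de : d <= e / 16 by rewrite ge_min lexx.
have d16 : d <= 16^-1 by rewrite ge_min lexx orbT.
pose m := (Num.trunc d^-1).+1.
have md : m%:R^-1 <= d.
  rewrite -[leRHS]invrK lef_pV2 ?posrE ?ltr0n ?invr_gt0// ltW//.
  by rewrite truncnS_gt.
near=> N.
have N1 : (1 < N)%N by near: N; exact: nbhs_infty_gt.
have N0 : (0 < N)%N by exact: ltnW.
have L0 : 0 < ln N%:R :> R by rewrite ln_gt0// ltr1n.
have hq : `|1 - B N / A N| <= d.
  by near: N; move/cvgrPdist_le: cvg_B_A; exact.
have hL : d^-1 * (1 + ln m%:R) <= ln N%:R.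
  by near: N; move/cvgryPge: ln_nat_cvgy; exact.
have A0 : 0 < A N by exact: sum_prime_weight_gt0.
have hm : 0 <= ln m%:R :> R by rewrite ln_ge0// ler1n.
have h1 := @ln_nth_prime_le R N N0.
have h2 := @A_le N m N0 isT.
have h3 := le_ln_nth_prime N.
have hL1 : 1 + ln m%:R <= d * ln N%:R by rewrite -ler_pdivrMl.
have hrm : ln (nth_prime N)%:R / m%:R <= ln (nth_prime N)%:R * d.
  by rewrite ler_wpM2l// (le_trans (ltW L0)).
have hb : B N <= A N + d * A N.
  move: hq; rewrite ler_norml => /andP[+ _].
  move=> hd; have : B N / A N <= 1 + d by lra.
  by rewrite ler_pdivrMr// mulrDl mul1r.
move: L0 A0 h1 h2 h3 hL1 hrm hb hm; set L := ln N%:R; set r := ln _.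
set b := B N; set x := A N; set lm := ln m%:R; set y := r / _.
move=> L0 A0 h1 h2 h3 hL1 hrm hb hm.
have dL : d * L <= 16^-1 * L by rewrite ler_pM2r.
have dx : d * x <= 16^-1 * x by rewrite ler_pM2r.
have r0 : 0 < r by exact: lt_le_trans h3.
have rd : r * d <= r * 16^-1 by rewrite ler_pM2l.
have r2 : r <= 2 * L by lra.
have x2 : x <= 2 * L by lra.
have rd2 : r * d <= 2 * (d * L) by rewrite mulrC mulrCA ler_pM2l.
have dx2 : d * x <= 2 * (d * L) by rewrite mulrCA ler_pM2l.
have de2 : d * L <= e / 16 * L by rewrite ler_pM2r.
have eL : 0 < e * L by rewrite mulr_gt0.
have E z : `|1 - z / L| <= e <-> `|L - z| <= e * L.
  rewrite -{2}(mul1r L) -{2}(divfK (negbT (gt_eqF L0)) z) -mulrBl normrM.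
  by rewrite (gtr0_norm L0) ler_pM2r.
by split; apply/E; rewrite ler_norml; apply/andP; split; lra.
Unshelve. all: by end_near. Qed.

Lemma ln_nth_prime_asympt :
  ln (nth_prime N)%:R / ln N%:R @[N --> \oo] --> (1 : R).
Proof.
apply/cvgrPdist_le => e e0.
by apply: filterS (ratio_asympt e0) => N [].
Qed.

(** Mertens' first theorem, up to [o(ln N)]. *)
Lemma sum_prime_weight_asympt : A N / ln N%:R @[N --> \oo] --> (1 : R).
Proof.
apply/cvgrPdist_le => e e0.
by apply: filterS (ratio_asympt e0) => N [].
Qed.

(** The weights are the increments of [A], and the logarithm of the [i]-th prime
    is asymptotic to [A i]: this is a Riemann sum of [x ^ l] over the interval
    from [0] to [A N], so that the logarithms of the primes, rescaled, are
    distributed by the weights like a uniform variable. *)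
Lemma prime_weight_moment_asympt (l : nat) :
  \sum_(i < N) a i / ln N%:R * (ln (p i) / ln N%:R) ^+ l @[N --> \oo]
    --> (l.+1%:R^-1 : R).
Proof.
pose S N := A N.
have S1 N : S N.+1 = S N + a N by rewrite /S big_ord_recr.
have S_ge0 N : 0 <= S N by apply: sumr_ge0 => i _; rewrite ltW// prime_weight_gt0.
(* [b i] is the increment of [S ^ l.+1]: as Cesaro weights they telescope *)
pose s i := \sum_(k < l.+1) S i.+1 ^+ (l - k) * S i ^+ k.
pose b i := a i * s i.
have bE i : b i = S i.+1 ^+ l.+1 - S i ^+ l.+1.
  by rewrite subrXX /b; congr (_ * _); rewrite S1 addrAC subrr add0r.
have s_gt0 i : 0 < s i.
  rewrite /s big_ord_recl subn0 expr0 mulr1 ltr_pwDl ?exprn_gt0 ?sum_prime_weight_gt0//.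
  by apply: sumr_ge0 => k _; rewrite mulr_ge0// exprn_ge0.
have sumb N : \sum_(i < N) b i = S N ^+ l.+1.
  elim: N => [|N IH]; first by rewrite /S !big_ord0 expr0n.
  by rewrite big_ord_recr /= IH bE addrC subrK.
pose c i := ln (p i) ^+ l / s i.
have cvg1 : S i.+1 / ln (p i) @[i --> \oo] --> (1 : R).
  have h : S i / ln (nth_prime i)%:R @[i --> \oo] --> (1 : R).
    have h := cvgn_div sum_prime_weight_asympt ln_nth_prime_asympt (oner_neq0 R).
    rewrite divr1 in h; apply: cvg_trans h; apply: near_eq_cvg; near=> i.
    have i1 : (1 < i)%N by near: i; exact: nbhs_infty_gt.
    have : 0 < ln i%:R :> R by rewrite ln_gt0// ltr1n.
    have : 0 < ln (nth_prime i)%:R :> R by case: (i) i1 => // j _; exact: ln_nth_primeS_gt0.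
    rewrite /= /S; move: (ln _) (ln _) (A i) => x y z x0 y0; field; lra.
  by rewrite -cvg_shiftS in h.
have cvg2 : S i / ln (p i) @[i --> \oo] --> (1 : R).
  have h : S i.+1 / ln (p i) - (p i)^-1 @[i --> \oo] --> (1 - 0 : R).
    by apply: cvgB; [exact: cvg1 | exact: cvg_inv_nth_prime].
  rewrite subr0 in h; apply: cvg_trans h; apply: near_eq_cvg; apply: nearW => i /=; rewrite S1.
  have := ln_nth_primeS_gt0 i; have := nth_primeS_gt1 i; rewrite /a.
  move: (ln (p i)) (p i) (S i) => x y z y0 x0.
  by field; apply/andP; split; lra.
have cvgc : c i @[i --> \oo] --> (l.+1%:R^-1 : R).
  have h : s i / ln (p i) ^+ l @[i --> \oo] --> (l.+1%:R : R).
    have -> : (fun i => s i / ln (p i) ^+ l) = (fun i =>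
        \sum_(k < l.+1) (S i.+1 / ln (p i)) ^+ (l - k) * (S i / ln (p i)) ^+ k).
      apply/funext => i; rewrite /s mulr_suml; apply: eq_bigr => k _.
      rewrite !expr_div_n mulrACA -invfM -exprD subnK.
        by [].
      by rewrite -ltnS ltn_ord.
    rewrite [X in _ --> X](_ : _ = \sum_(k < l.+1) (1 ^+ (l - k) * 1 ^+ k)); last first.
      under eq_bigr do rewrite !expr1n mulr1.
      by rewrite sumr_const card_ord.
    apply: cvg_finite_sum => k; apply: cvgM.
      exact: cvgn_exp cvg1.
    exact: cvgn_exp cvg2.
  have l0 : l.+1%:R != 0 :> R by rewrite pnatr_eq0.
  have h1 : (s i / ln (p i) ^+ l)^-1 @[i --> \oo] --> (l.+1%:R^-1 : R).
    exact: cvgV l0 h.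
  by under eq_fun do rewrite /c -invf_div.
have b0 i : 0 <= b i by rewrite mulr_ge0 ?ltW ?prime_weight_gt0.
have bo : \sum_(i < n) b i @[n --> \oo] --> +oo.
  apply/cvgryPge => M; near=> n.
  have hM : M <= S n by near: n; move/cvgryPge: sum_prime_weight_cvgy; exact.
  have h1 : 1 <= S n by near: n; move/cvgryPge: sum_prime_weight_cvgy; exact.
  by rewrite sumb (le_trans hM)// exprS ler_peMr// exprn_ege1.
have h1 := weighted_cesaro b0 bo cvgc.
have h2 : (A N / ln N%:R) ^+ l.+1 @[N --> \oo] --> (1 ^+ l.+1 : R).
  exact: cvgn_exp sum_prime_weight_asympt.
have := cvgn_mul h2 h1; rewrite expr1n mul1r.
apply: cvg_trans; apply: near_eq_cvg; near=> N => /=.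
have N1 : (1 < N)%N by near: N; exact: nbhs_infty_gt.
have L0 : 0 < ln N%:R :> R by rewrite ln_gt0// ltr1n.
have A0 : 0 < S N by rewrite sum_prime_weight_gt0// ltnW.
have -> : \sum_(i < N) b i * c i = \sum_(i < N) a i * ln (p i) ^+ l.
  apply: eq_bigr => i _; rewrite /b /c.
  by move: (s i) (s_gt0 i) => y y0; field; rewrite gt_eqF.
rewrite sumb -/(S N) expr_div_n.
have Sl0 : S N ^+ l.+1 != 0 by rewrite gt_eqF// exprn_gt0.
have Ll0 : ln N%:R ^+ l.+1 != 0 :> R by rewrite gt_eqF// exprn_gt0.
transitivity ((\sum_(i < N) a i * ln (p i) ^+ l) / ln N%:R ^+ l.+1).
  by move: (S N ^+ l.+1) Sl0 (ln N%:R ^+ l.+1) Ll0 => y y0 z z0; field; apply/andP.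
rewrite mulr_suml; apply: eq_bigr => i _.
by rewrite expr_div_n mulrACA -invfM -exprS.
Unshelve. all: by end_near. Qed.

(** A weighted Cesaro mean of the inverses of the primes. *)
Lemma prime_weight_error_asympt :
  \sum_(i < N) a i / ln N%:R / p i @[N --> \oo] --> (0 : R).
Proof.
have := cvgn_mul sum_prime_weight_asympt (weighted_cesaro
  (fun i => ltW (prime_weight_gt0 i)) sum_prime_weight_cvgy cvg_inv_nth_prime).
rewrite mulr0.
apply: cvg_trans; apply: near_eq_cvg; near=> N => /=.
have N1 : (1 < N)%N by near: N; exact: nbhs_infty_gt.
have L0 : 0 < ln N%:R :> R by rewrite ln_gt0// ltr1n.
have A0 : 0 < A N by rewrite sum_prime_weight_gt0// ltnW.
under [RHS]eq_bigr do rewrite mulrAC.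
rewrite -mulr_suml; move: (\sum_(i < N) (_ * _)) (A N) (ln _) A0 L0 => x y z y0 z0.
by field; apply/andP; split; lra.
Unshelve. all: by end_near. Qed.

End asymptotics.

(** * Size bias for masses proportional to 1/n *)

Section size_bias.
Variable R : realType.

Lemma sum_multiples (F : nat -> R) d K : (0 < d)%N ->
  \sum_(0 <= n < d * K | (d %| n)%N) F n = \sum_(0 <= m < K) F (d * m)%N.
Proof.
move=> d0; elim: K => [|K IH]; first by rewrite muln0 !big_geq.
rewrite big_nat_recr//= -IH big_mkcond [in RHS]big_mkcond mulnSr.
rewrite (big_cat_nat (n := d * K))//= ?leq_addr//; congr +%R.
rewrite -{1}[(d * K)%N]add0n [X in index_iota _ X]addnC big_addn addnK.
rewrite big_ltn// add0n dvdn_mulr// -[RHS]addr0; congr +%R.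
rewrite big_nat_cond big1// => r /andP[/andP[r1 rd] _].
by rewrite dvdn_addl ?dvdn_mulr// gtnNdvd.
Qed.

Lemma sum_multiples_le (F : nat -> R) d M : (0 < d)%N -> (forall n, 0 <= F n) ->
  \sum_(0 <= n < M | (d %| n)%N) F n <= \sum_(0 <= m < M) F (d * m)%N.
Proof.
move=> d0 F0; rewrite -sum_multiples// [leRHS]big_mkcond (big_cat_nat (n := M))//=.
  by rewrite -big_mkcond lerDl sumr_ge0// => n _; case: ifP.
exact: leq_pmull.
Qed.

Lemma le_sum_multiples (F : nat -> R) d M M' : (0 < d)%N -> (d * M <= M')%N ->
    (forall n, 0 <= F n) ->
  \sum_(0 <= m < M) F (d * m)%N <= \sum_(0 <= n < M' | (d %| n)%N) F n.
Proof.
move=> d0 dM F0; rewrite -sum_multiples// [leRHS]big_mkcond (big_cat_nat (n := d * M))//=.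
by rewrite -big_mkcond lerDl sumr_ge0// => n _; case: ifP.
Qed.

Lemma exp_le_fact_expR (x : R) k : 0 <= x -> x ^+ k <= k`!%:R * expR x.
Proof.
move=> x0; case: k => [|k].
  by rewrite fact0 mul1r expr0 -[leLHS]addr0 (le_trans _ (expR_ge1Dx x))// lerD2l.
rewrite mulrC -ler_pdivrMr ?ltr0n ?fact_gt0// (le_trans _ (expR_ge1Dxn k x0))//.
by rewrite lerDr.
Qed.

(** Prime powers beyond the first contribute only to the error term: for [p >= 2]
    the factor [p ^- a] is at most [p ^- 2] times [2 ^- (a - 2)], and the
    geometric decay absorbs [a ^ k]. *)
Lemma sum_higher_powers_bounded (k : nat) : exists2 K : R, 0 <= K &
  forall (p : R) (M : nat), 2 <= p ->
    \sum_(2 <= a < M) p ^- a * a%:R ^+ k <= K * p ^- 2.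
Proof.
(* the base [3 / 2] dominates the powers [a ^ k] and leaves a geometric series of
   ratio [q = 3 / 4] after division by [2 ^ a] *)
pose y : R := ln (3 / 2); have y0 : 0 < y by rewrite ln_gt0//; lra.
have expy n : expR (n%:R * y) = (3 / 2) ^+ n.
  by rewrite expRM_natl lnK// posrE; lra.
have [c c0 H] : exists2 c : R, 0 <= c & forall n, n%:R ^+ k <= c * (3 / 2) ^+ n.
  exists (k`!%:R / y ^+ k) => [|n]; first by rewrite divr_ge0// exprn_ge0// ltW.
  rewrite -expy mulrAC ler_pdivlMr ?exprn_gt0// -exprMn.
  by apply: exp_le_fact_expR; rewrite mulr_ge0// ltW.
exists (9 * c); first by rewrite mulr_ge0.
move=> p M p2; have p0 : 0 < p by lra.
case: (ltnP M 2) => M2.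
  rewrite big_geq; last exact: ltnW.
  by apply: mulr_ge0; [exact: mulr_ge0 | rewrite invr_ge0 exprn_ge0// ltW].
rewrite -[X in index_iota X](add0n 2%N) big_addn.
set q : R := 3 / 4.
apply: (@le_trans _ _ (p ^- 2 * (c * (9 / 4)) * \sum_(0 <= b < M - 2) q ^+ b)).
  rewrite mulr_sumr big_nat_cond [leRHS]big_nat_cond; apply: ler_sum => b _.
  have -> : p ^- (b + 2) = p ^- 2 * p ^- b by rewrite exprD invfM mulrC.
  rewrite -!mulrA ler_pM2l ?invr_gt0 ?exprn_gt0//.
  apply: (@le_trans _ _ (2 ^- b * (c * (3 / 2) ^+ (b + 2)))).
    apply: ler_pM; [by rewrite invr_ge0 exprn_ge0// ltW | by rewrite exprn_ge0 | |exact: H].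
    by rewrite lef_pV2 ?posrE ?exprn_gt0// lerXn2r ?nnegrE// ltW.
  have -> : q ^+ b = 2 ^- b * (3 / 2) ^+ b.
    by rewrite -exprVn -exprMn; congr (_ ^+ _); rewrite /q; lra.
  by rewrite exprD; move: (2 ^+ b)^-1 ((3 / 2) ^+ b) => u v; lra.
have geo m : \sum_(0 <= b < m) q ^+ b = 4 * (1 - q ^+ m).
  elim: m => [|m IH]; first by rewrite big_geq// expr0 subrr mulr0.
  by rewrite big_nat_recr//= IH exprS /q; move: (_ ^+ m) => z; lra.
rewrite geo [leRHS]mulrC -mulrA ler_pM2l ?invr_gt0 ?exprn_gt0//.
have z0 : 0 <= q ^+ (M - 2) by rewrite exprn_ge0// /q; lra.
have : 0 <= c * q ^+ (M - 2) by exact: mulr_ge0.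
by move: (q ^+ _) => z; lra.
Qed.

End size_bias.

Lemma logn_le_count_dvd q n M : prime q -> (n < M)%N ->
  (logn q n <= \sum_(1 <= a < M) (q ^ a %| n))%N.
Proof.
move=> qp nM; case: (posnP n) => [->|n0]; first by rewrite logn0.
by rewrite logn_count_dvd// [leqRHS](big_cat_nat (n := n))//= ?leq_addr// ltnW.
Qed.

Section harmonic_weights.
Variables (R : realType) (N : nat) (T : set nat) (c : R).
Hypothesis c0 : 0 <= c.
Hypothesis T_gt0 : forall n, T n -> (0 < n)%N.
Hypothesis T_dvd : forall n d, T n -> (d %| n)%N -> T d.
Hypothesis T_primeM : forall i m, (i < N)%N -> T m ->
  ~~ (nth_prime i.+1 %| m)%N -> T (nth_prime i.+1 * m)%N.
Hypothesis T_primes : forall n q, T n -> prime q -> (q %| n)%N ->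
  exists2 i, (i < N)%N & nth_prime i.+1 = q.

(** The natural probability and its conditionings on the k-free integers all have
    this form, for a support [T] and a normalizing constant [c]. *)
Definition harmonic_weight (n : nat) : R := if n \in T then c / n%:R else 0.

Local Notation w := harmonic_weight.
Local Notation p i := (nth_prime i.+1).

Lemma harmonic_weight_ge0 n : 0 <= w n.
Proof. by rewrite /w; case: ifP => // _; rewrite divr_ge0. Qed.

Let p_gt0 i : (0 < p i)%N. Proof. by rewrite prime_gt0// nth_prime_prime. Qed.

Lemma harmonic_weightM_le d n : (0 < d)%N -> w (d * n) <= w n / d%:R.
Proof.
move=> d0; rewrite /w; case: ifPn => [/set_mem Tdn|_].
  rewrite mem_set; last by apply: T_dvd Tdn _; exact: dvdn_mull.
  by rewrite natrM invfM (mulrC d%:R^-1) mulrA.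
by rewrite divr_ge0// harmonic_weight_ge0.
Qed.

Lemma harmonic_weight_primeM i m : (i < N)%N -> ~~ (p i %| m)%N ->
  w m / (p i)%:R <= w (p i * m).
Proof.
move=> iN pm; rewrite {1}/w; case: ifPn => [/set_mem Tm|_].
  rewrite /w mem_set; last exact: T_primeM.
  by rewrite natrM invfM (mulrC (p i)%:R^-1) mulrA.
by rewrite mul0r harmonic_weight_ge0.
Qed.

Section one_test_function.
Variable g : nat -> R.
Hypothesis g0 : forall n, 0 <= g n.

Let wg0 n : 0 <= w n * g n. Proof. by rewrite mulr_ge0// harmonic_weight_ge0. Qed.

Let sum_multiples_weight_le d M : (0 < d)%N ->
  \sum_(0 <= n < M | (d %| n)%N) w n * g n <=
  d%:R^-1 * \sum_(0 <= m < M) w m * g (d * m)%N.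
Proof.
move=> d0; apply: le_trans (sum_multiples_le (F := fun n => w n * g n) M d0 wg0) _.
rewrite mulr_sumr; apply: ler_sum => m _; rewrite mulrA [_^-1 * _]mulrC.
by rewrite ler_wpM2r// harmonic_weightM_le.
Qed.

Let ln_weight n : w n * ln n%:R =
  \sum_(i < N) w n * (logn (p i) n)%:R * ln (p i)%:R.
Proof.
rewrite /w; case: ifPn => [/set_mem Tn|_]; last first.
  by rewrite mul0r big1// => i _; rewrite !mul0r.
rewrite -(@sum_logn_first_primes_eq R N n (T_gt0 Tn)); last by move=> q; exact: T_primes.
by rewrite mulr_sumr; apply: eq_bigr => i _; rewrite mulrA.
Qed.

(** Write [ln n] as the sum of [ln q] over the prime powers [q ^ a] dividing [n],
    and then each such [n] as [q ^ a * m]. *)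
Lemma sum_weight_ln_le M :
  \sum_(0 <= n < M) w n * ln n%:R * g n <=
  \sum_(i < N) ln (p i)%:R * \sum_(1 <= a < M) (p i)%:R ^- a *
     \sum_(0 <= m < M) w m * g (p i ^ a * m)%N.
Proof.
apply: (@le_trans _ _ (\sum_(i < N) ln (p i)%:R * \sum_(1 <= a < M)
    \sum_(0 <= n < M | (p i ^ a %| n)%N) w n * g n)); last first.
  apply: ler_sum => i _; rewrite ler_wpM2l ?ln_ge0 ?ler1n ?p_gt0//.
  apply: ler_sum => a _; rewrite -natrX.
  by apply: sum_multiples_weight_le; rewrite expn_gt0 p_gt0.
under eq_bigr do rewrite ln_weight mulr_suml.
rewrite exchange_big/=; apply: ler_sum => i _.
under [X in _ * X]eq_bigr do rewrite big_mkcond.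
rewrite exchange_big/= mulr_sumr; apply: ler_sum_nat => n /andP[_ nM].
rewrite mulrAC mulrC ler_wpM2l ?ln_ge0 ?ler1n ?p_gt0//.
apply: (@le_trans _ _ ((\sum_(1 <= a < M) (p i ^ a %| n))%:R * (w n * g n))).
  by rewrite mulrAC mulrC ler_wpM2r// ler_nat logn_le_count_dvd// nth_prime_prime.
rewrite natr_sum mulr_suml; apply: ler_sum => a _.
by case: ifP => _; rewrite ?mul1r ?mul0r.
Qed.

(** A prime [q] not dividing [m] can be added as a factor inside [T]; the [m]
    that it divides are given up, at the price of one more factor [q^-1]. *)
Lemma le_sum_weight_ln M M' : (forall i, (i < N)%N -> (p i * M <= M')%N) ->
  \sum_(i < N) ln (p i)%:R / (p i)%:R *
    (\sum_(0 <= m < M) w m * g (p i * m)%N -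
     (p i)%:R^-1 * \sum_(0 <= m < M) w m * g (p i * (p i * m))%N)
  <= \sum_(0 <= n < M') w n * ln n%:R * g n.
Proof.
move=> pM; under [leRHS]eq_bigr do rewrite ln_weight mulr_suml.
rewrite exchange_big/=; apply: ler_sum => i _.
apply: (@le_trans _ _ (ln (p i)%:R * \sum_(0 <= n < M' | (p i %| n)%N) w n * g n)); last first.
  rewrite mulr_sumr big_mkcond; apply: ler_sum => n _.
  rewrite mulrAC [leRHS]mulrC; case: ifPn => [pn|_]; last first.
    by rewrite mulr_ge0 ?ln_ge0 ?ler1n ?p_gt0// mulrAC mulr_ge0.
  rewrite ler_wpM2l ?ln_ge0 ?ler1n ?p_gt0// mulrAC.
  case: (posnP n) => [->|n0].
    rewrite /w memNset ?mul0r// => /T_gt0; by rewrite ltnn.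
  by rewrite ler_peMr// ler1n logn_gt0 mem_primes n0 pn nth_prime_prime.
rewrite -mulrA ler_wpM2l ?ln_ge0 ?ler1n ?p_gt0//.
apply: le_trans (le_sum_multiples (F := fun n => w n * g n) (p_gt0 i) (pM i (ltn_ord i)) wg0).
set q := p i; have q0 : 0 < q%:R :> R by rewrite ltr0n p_gt0.
apply: (@le_trans _ _ (\sum_(0 <= m < M | ~~ (q %| m)%N) w (q * m)%N * g (q * m)%N)); last first.
  rewrite [leRHS](bigID (fun m => (q %| m)%N))/= lerDr.
  by apply: sumr_ge0.
apply: (@le_trans _ _ (q%:R^-1 * \sum_(0 <= m < M | ~~ (q %| m)%N) w m * g (q * m)%N)); last first.
  rewrite mulr_sumr; apply: ler_sum => m qm; rewrite mulrA ler_wpM2r// mulrC.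
  exact: harmonic_weight_primeM.
rewrite ler_pM2l ?invr_gt0// [X in X - _](bigID (fun m => (q %| m)%N))/=.
rewrite lerBlDr [leRHS]addrC lerD2r.
have F0 n : 0 <= w n * g (q * n)%N by rewrite mulr_ge0// harmonic_weight_ge0.
apply: le_trans (sum_multiples_le (F := fun n => w n * g (q * n)%N) M (p_gt0 i) F0) _.
rewrite mulr_sumr; apply: ler_sum => m _; rewrite mulrA ler_wpM2r// mulrC.
exact: harmonic_weightM_le.
Qed.

End one_test_function.

Hypothesis N_gt1 : (1 < N)%N.
Hypothesis sum_weight_le1 : forall M, \sum_(0 <= n < M) w n <= 1.

Local Notation L := (ln N%:R : R).
Local Notation X := (log_ratio R N).
Local Notation a i := (prime_weight R i / L).
Local Notation u i := (ln (p i)%:R / L).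
Local Notation r := (ln (nth_prime N)%:R / L).

Let L_gt0 : 0 < L. Proof. by rewrite ln_gt0// ltr1n. Qed.

Let X_ge0 n : 0 <= X n.
Proof.
rewrite divr_ge0 ?(ltW L_gt0)//; case: n => [|n]; first by rewrite ln0.
by rewrite ln_ge0// ler1n.
Qed.

Let XM d m : (0 < d)%N -> (0 < m)%N -> X (d * m)%N = X m + ln d%:R / L.
Proof.
by move=> d0 m0; rewrite /log_ratio natrM lnM ?posrE ?ltr0n// mulrDl addrC.
Qed.

Let u_ge0 i : 0 <= u i.
Proof. by rewrite divr_ge0// ltW// ln_nth_primeS_gt0. Qed.

Let u_le i : (i < N)%N -> u i <= r.
Proof.
move=> iN; rewrite ler_pM2r ?invr_gt0// ler_ln ?posrE ?ltr0n ?prime_gt0 ?nth_prime_prime ?(ltnW N_gt1)//.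
rewrite ler_nat; move: iN; rewrite leq_eqVlt => /predU1P[->//|].
by move/ltn_nth_prime/ltnW.
Qed.

Let a_ge0 i : 0 <= a i.
Proof. by rewrite divr_ge0 ?ltW ?prime_weight_gt0. Qed.

(** Truncated at [M], all sums stay finite while the existence of the moments is
    being proved. *)
Definition partial_moment (M k : nat) (b : R) : R :=
  \sum_(0 <= m < M) w m * (X m + b) ^+ k.
Local Notation mom := partial_moment.

Let mom_ge0 M k b : 0 <= b -> 0 <= mom M k b.
Proof.
move=> b0; apply: sumr_ge0 => m _.
by rewrite mulr_ge0 ?harmonic_weight_ge0// exprn_ge0// addr_ge0.
Qed.

Let weight_shift d k m : (0 < d)%N ->
  w m * X (d * m)%N ^+ k = w m * (X m + ln d%:R / L) ^+ k.
Proof.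
move=> d0; case: (posnP m) => [->|m0]; last by rewrite XM.
by rewrite /w memNset ?mul0r// => /T_gt0; rewrite ltnn.
Qed.

Let sum_weight_lnX M k :
  \sum_(0 <= n < M) w n * ln n%:R * X n ^+ k = L * mom M k.+1 0.
Proof.
rewrite mulr_sumr; apply: eq_bigr => n _; rewrite addr0 exprS /log_ratio.
by move: (_ ^+ k) => z; field; rewrite gt_eqF.
Qed.

Section error_constant.
Variables (k : nat) (K : R).
Hypothesis K0 : 0 <= K.
Hypothesis KP : forall (q : R) M, 2 <= q ->
  \sum_(2 <= e < M) q ^- e * e%:R ^+ k <= K * q ^- 2.

Let p_ge2 i : 2 <= (p i)%:R :> R.
Proof. by rewrite ler_nat prime_gt1// nth_prime_prime. Qed.

(** The upper half of the size-bias comparison. A prime shifts [X] by [u i], its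
    [e]-th power shifts it by [e * u i], and [X + e * u i] is at most [e] times
    [X + 2 * r]. *)
Lemma partial_moment_le M : mom M k.+1 0 <=
  \sum_(i < N) a i * (mom M k (u i) + K / (p i)%:R * mom M k (2 * r)).
Proof.
rewrite -(ler_pM2l L_gt0) -sum_weight_lnX.
apply: le_trans (@sum_weight_ln_le (fun n => X n ^+ k) _ M) _.
  by move=> n; exact: exprn_ge0.
rewrite mulr_sumr; apply: ler_sum => i _.
have pi0 : 0 < (p i)%:R :> R by rewrite ltr0n p_gt0.
have u2r : u i <= 2 * r.
  by have := u_le (ltn_ord i); have := u_ge0 i; lra.
have r0 : 0 <= 2 * r by exact: le_trans (u_ge0 i) u2r.
rewrite /prime_weight [leRHS](_ : _ = ln (p i)%:R * ((p i)%:R^-1 *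
    (mom M k (u i) + K / (p i)%:R * mom M k (2 * r)))); last first.
  by field; rewrite !gt_eqF.
rewrite ler_wpM2l ?ln_ge0 ?ler1n ?p_gt0//.
have -> : \sum_(1 <= e < M) (p i)%:R ^- e * \sum_(0 <= m < M) w m * X (p i ^ e * m)%N ^+ k =
   \sum_(1 <= e < M) (p i)%:R ^- e * mom M k (e%:R * u i).
  apply: eq_bigr => e _; congr (_ * _); apply: eq_bigr => m _.
  rewrite weight_shift ?expn_gt0 ?p_gt0// natrX lnXn ?ltr0n ?p_gt0// -[ln _ *+ e]mulr_natl.
  by rewrite -[in LHS]mulrA.
have rhs0 : 0 <= mom M k (u i) + K / (p i)%:R * mom M k (2 * r).
  apply: addr_ge0; first exact: mom_ge0.
  by apply: mulr_ge0; [exact: divr_ge0 (ltW pi0) | exact: mom_ge0].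
case: (leqP M 1) => M1.
  by rewrite big_geq//; apply: mulr_ge0; rewrite ?invr_ge0.
rewrite big_ltn// expr1 mul1r mulrDr lerD2l.
apply: (@le_trans _ _ (\sum_(2 <= e < M) (p i)%:R ^- e * e%:R ^+ k * mom M k (2 * r))).
  apply: ler_sum_nat => e /andP[e2 _]; rewrite -mulrA ler_wpM2l ?invr_ge0 ?exprn_ge0//.
  rewrite mulr_sumr; apply: ler_sum => m _.
  rewrite [leRHS]mulrCA ler_wpM2l ?harmonic_weight_ge0// -exprMn.
  have e1 : 1 <= e%:R :> R by rewrite ler1n ltnW.
  have eX : X m <= e%:R * X m by rewrite ler_peMl.
  have eu : e%:R * u i <= e%:R * (2 * r) by rewrite ler_wpM2l.
  have eu0 : 0 <= e%:R * u i by rewrite mulr_ge0.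
  have Xm := X_ge0 m.
  by rewrite lerXn2r ?nnegrE//; lra.
rewrite -mulr_suml [leRHS]mulrA ler_wpM2r ?mom_ge0//.
by rewrite mulrCA -invfM -expr2; exact: KP.
Qed.

Lemma le_partial_moment M :
  \sum_(i < N) a i * (mom M k (u i) - (p i)%:R^-1 * mom M k (2 * r)) <=
  mom (nth_prime N * M) k.+1 0.
Proof.
rewrite -(ler_pM2l L_gt0) -sum_weight_lnX.
apply: le_trans (@le_sum_weight_ln (fun n => X n ^+ k) _ M _ _); last 2 first.
- by move=> n; exact: exprn_ge0.
- move=> i iN; rewrite leq_mul2r; apply/orP; right.
  move: iN; rewrite leq_eqVlt => /predU1P[->//|].
  by move/ltn_nth_prime/ltnW.
rewrite mulr_sumr; apply: ler_sum => i _.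
rewrite /prime_weight [leLHS](_ : _ = ln (p i)%:R / (p i)%:R *
    (mom M k (u i) - (p i)%:R^-1 * mom M k (2 * r))); last first.
  by field; rewrite !gt_eqF// ltr0n p_gt0.
rewrite ler_wpM2l ?divr_ge0 ?ln_ge0 ?ler1n ?p_gt0//; apply: lerB.
  by apply: ler_sum => m _; rewrite weight_shift ?p_gt0.
rewrite ler_wpM2l ?invr_ge0//; apply: ler_sum => m _.
rewrite mulnA weight_shift ?muln_gt0 ?p_gt0// ler_wpM2l ?harmonic_weight_ge0//.
rewrite natrM lnM ?posrE ?ltr0n ?p_gt0// mulrDl.
have := u_le (ltn_ord i); have := u_ge0 i; have := X_ge0 m => x0 u0 ur.
by rewrite lerXn2r ?nnegrE//; lra.
Qed.

End error_constant.

Definition moment (k : nat) : R := limn (fun M => mom M k 0).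

(** The [k]-th moment of [X + b]. *)
Definition shifted_moment (k : nat) (b : R) : R :=
  \sum_(l < k.+1) moment (k - l) * b ^+ l *+ 'C(k, l).

Let mom_nd k : {homo (fun M => mom M k 0) : m n / (m <= n)%N >-> m <= n}.
Proof.
move=> m n mn; rewrite /mom [leRHS](big_cat_nat (n := m))//= lerDl.
apply: sumr_ge0 => i _; rewrite mulr_ge0 ?harmonic_weight_ge0//.
by rewrite exprn_ge0// addr0.
Qed.

Let momD M k b : mom M k b = \sum_(l < k.+1) mom M (k - l) 0 * b ^+ l *+ 'C(k, l).
Proof.
under [RHS]eq_bigr do rewrite /mom mulr_suml -sumrMnl.
rewrite exchange_big/=; apply: eq_bigr => m _.
rewrite exprDn mulr_sumr; apply: eq_bigr => l _.
by rewrite addr0 mulrnAr mulrA.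
Qed.

Let cvg_momD k b : (forall j, (j <= k)%N -> cvgn (fun M => mom M j 0)) ->
  mom M k b @[M --> \oo] --> shifted_moment k b.
Proof.
move=> h; under eq_fun do rewrite momD.
apply: cvg_finite_sum => l.
under eq_fun do rewrite -mulr_natr; rewrite -mulr_natr.
apply: cvgn_mul; last exact: cvg_cst.
by apply: cvgn_mul; [exact/h/leq_subr | exact: cvg_cst].
Qed.

Let mom_le_lim k b M : (forall j, (j <= k)%N -> cvgn (fun M => mom M j 0)) ->
  0 <= b -> mom M k b <= shifted_moment k b.
Proof.
move=> h b0; rewrite momD; apply: ler_sum => l _; rewrite lerMn2r; apply/orP; right.
rewrite ler_wpM2r ?exprn_ge0//; apply: nondecreasing_cvgn_le.
  exact: mom_nd.
exact/h/leq_subr.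
Qed.

Let r_ge0 : 0 <= 2 * r.
Proof.
by rewrite mulr_ge0// divr_ge0 ?(ltW L_gt0)// ln_ge0// ler1n prime_gt0// nth_prime_prime// ltnW.
Qed.

(** By strong induction: the upper size-bias bound controls a moment by those of
    smaller order. *)
Let cvg_mom k : cvgn (fun M => mom M k 0).
Proof.
have [j] := ubnP k; elim: j => // j IH in k *; rewrite ltnS => kj.
apply: nondecreasing_is_cvgn; first exact: mom_nd.
case: k kj => [|k] kj.
  exists 1 => _ [M _ <-]; apply: le_trans (sum_weight_le1 M).
  by apply: ler_sum => n _; rewrite expr0 mulr1.
have {}IH i : (i <= k)%N -> cvgn (fun M => mom M i 0).
  by move=> ik; apply: IH; exact: leq_ltn_trans kj.
have [K K0 KP] := sum_higher_powers_bounded R k.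
exists (\sum_(i < N) a i * (shifted_moment k (u i) + K / (p i)%:R * shifted_moment k (2 * r))).
move=> _ [M _ <-]; apply: le_trans (partial_moment_le K0 KP M) _.
apply: ler_sum => i _; rewrite ler_wpM2l//; apply: lerD; first exact: mom_le_lim.
by rewrite ler_wpM2l ?divr_ge0//; exact: mom_le_lim.
Qed.

Lemma cvg_moment k : mom M k 0 @[M --> \oo] --> moment k.
Proof. exact: cvg_mom. Qed.

(** The law of [X], biased by [X], is close to the law of [X + u] with [u]
    independent and equal to [u i] with mass [a i]. The upper bound exceeds this by
    the higher prime powers, the lower bound misses the multiples of [p i]; both
    defects carry an extra factor [1 / p i]. *)
Lemma moment_size_bias k K : 0 <= K ->
    (forall (q : R) M, 2 <= q ->
       \sum_(2 <= e < M) q ^- e * e%:R ^+ k <= K * q ^- 2) ->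
  `|moment k.+1 - \sum_(l < k.+1)
      moment (k - l) * (\sum_(i < N) a i * u i ^+ l) *+ 'C(k, l)| <=
  (1 + K) * (\sum_(i < N) a i / (p i)%:R) * shifted_moment k (2 * r).
Proof.
move=> K0 KP.
have -> : \sum_(l < k.+1)
      moment (k - l) * (\sum_(i < N) a i * u i ^+ l) *+ 'C(k, l) =
   \sum_(i < N) a i * shifted_moment k (u i).
  under [RHS]eq_bigr do rewrite mulr_sumr.
  rewrite exchange_big/=; apply: eq_bigr => l _.
  rewrite mulr_sumr -sumrMnl; apply: eq_bigr => i _.
  by rewrite mulrnAr; congr (_ *+ _); rewrite mulrCA.
set E := \sum_(i < N) a i / (p i)%:R; set S := shifted_moment k (2 * r).
have S0 : 0 <= S.
  apply: (@le_trans _ _ (mom 0 k (2 * r))); first exact: mom_ge0.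
  by apply: mom_le_lim => // j _; exact: cvg_mom.
have E0 : 0 <= E by apply: sumr_ge0 => i _; rewrite divr_ge0.
have ES0 : 0 <= E * S by exact: mulr_ge0.
have KES0 : 0 <= K * (E * S) by exact: mulr_ge0.
have upper : moment k.+1 <= \sum_(i < N) a i * shifted_moment k (u i) + K * (E * S).
  apply: limr_le; first exact: cvg_mom.
  apply: nearW => M; apply: le_trans (partial_moment_le K0 KP M) _.
  have -> : K * (E * S) = \sum_(i < N) a i / (p i)%:R * S * K.
    by rewrite mulrC /E !mulr_suml.
  rewrite -big_split/=.
  apply: ler_sum => i _; rewrite mulrDr; apply: lerD.
    by rewrite ler_wpM2l//; apply: mom_le_lim => // j _; exact: cvg_mom.
  rewrite [leLHS](_ : _ = a i / (p i)%:R * mom M k (2 * r) * K).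
    rewrite ler_wpM2r// ler_wpM2l//; first by rewrite divr_ge0.
    by apply: mom_le_lim => // j _; exact: cvg_mom.
  by move: (a i) (_^-1) (mom M k (2 * r)) => x y z; ring.
have lower : \sum_(i < N) a i * shifted_moment k (u i) - E * S <= moment k.+1.
  have h : \sum_(i < N) a i * (mom M k (u i) - (p i)%:R^-1 * mom M k (2 * r)) @[M --> \oo]
     --> \sum_(i < N) a i * (shifted_moment k (u i) - (p i)%:R^-1 * S).
    apply: cvg_finite_sum => i; apply: cvgn_mul; first exact: cvg_cst.
    apply: cvgB; first exact: cvg_momD.
    by apply: cvgn_mul; [exact: cvg_cst | exact: cvg_momD].
  rewrite [leLHS](_ : _ = \sum_(i < N) a i * (shifted_moment k (u i) - (p i)%:R^-1 * S)).
    rewrite -(cvg_lim (@Rhausdorff R) h); apply: limr_le; first exact: cvgP h.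
    apply: nearW => M; apply: le_trans (le_partial_moment k M) _.
    by apply: nondecreasing_cvgn_le; [exact: mom_nd | exact: cvg_mom].
  rewrite mulr_suml -sumrB; apply: eq_bigr => i _.
  by rewrite mulrBr mulrA.
by rewrite ler_norml; apply/andP; split; lra.
Qed.

End harmonic_weights.

(** * Moments of the logarithm under such masses *)

Section moments_of_natural_probabilities.
Variable R : realType.

Lemma ge0_integral_nat (Q : {measure set nat -> \bar R}) (g : nat -> R) :
  (forall n, 0 <= g n) ->
  (\int[Q]_n (g n)%:E = \sum_(0 <= n <oo) ((g n)%:E * Q [set n]))%E.
Proof.
move=> g0; have -> : [set: nat] = \bigcup_n [set n].
  by apply/seteqP; split => n // _; exists n.
rewrite ge0_integral_bigcup//=.
- apply: eq_eseriesr => n _.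
  rewrite (eq_integral (cst (g n)%:E)); last by move=> m; rewrite inE => ->.
  by rewrite integral_cst.
- by move=> n _; rewrite lee_fin.
- by move=> i j _ _ [m [/= <- <-]].
Qed.

Variables (N : nat) (T : set nat) (c : R) (Q : probability nat R).
Hypothesis c0 : 0 <= c.
Local Notation w := (harmonic_weight T c).
Hypothesis QE : forall n, Q [set n] = (w n)%:E.

Lemma integral_harmonic_weight (g : nat -> R) (l : R) : (forall n, 0 <= g n) ->
    \sum_(0 <= n < M) w n * g n @[M --> \oo] --> l ->
  (\int[Q]_n (g n)%:E = l%:E)%E.
Proof.
move=> g0 gl; rewrite ge0_integral_nat//; apply/cvg_lim => //.
have E M : (\sum_(0 <= n < M) (g n)%:E * Q [set n] =
    (\sum_(0 <= n < M) w n * g n)%:E)%E.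
  by rewrite -sumEFin; apply: eq_bigr => n _; rewrite QE -EFinM mulrC.
under eq_fun do rewrite E.
by apply: cvg_EFin => //; exact: nearW.
Qed.

Lemma sum_harmonic_weight_le1 M : \sum_(0 <= n < M) w n <= 1.
Proof.
have Q1 : (\int[Q]_n (1 : R)%:E = 1)%E.
  by rewrite integral_cst// mul1e; exact: probability_setT.
rewrite -lee_fin -Q1 (@ge0_integral_nat Q (fun=> 1))// -sumEFin.
under [leLHS]eq_bigr do rewrite -QE -[Q _]mul1e.
by apply: nneseries_lim_ge => n _ _; rewrite mul1e.
Qed.

End moments_of_natural_probabilities.

(** Closure under divisors gives the upper size-bias bound, closure under new
    prime factors the lower one. *)
Definition prime_extensible (N : nat) (T : set nat) : Prop :=
  [/\ forall n, T n -> (0 < n)%N,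
      forall n d, T n -> (d %| n)%N -> T d,
      forall i m, (i < N)%N -> T m -> ~~ (nth_prime i.+1 %| m)%N ->
        T (nth_prime i.+1 * m)%N &
      forall n q, T n -> prime q -> (q %| n)%N ->
        exists2 i, (i < N)%N & nth_prime i.+1 = q].

(** The recursion says that [E (X ^ k.+1) = E ((X + U) ^ k)] for [U] uniform in
    the unit interval and independent of [X]. *)
Definition dickman_moments (R : realType) (a : nat -> R) : Prop :=
  a 0 = 1 /\
  forall k, a k.+1 = \sum_(l < k.+1) a (k - l)%N * l.+1%:R^-1 *+ 'C(k, l).

Section moments_cvg.
Variables (R : realType) (T : nat -> set nat) (c : nat -> R).
Variable Q : nat -> probability nat R.
Hypothesis c0 : forall N, 0 <= c N.
Hypothesis T_ext : forall N, prime_extensible N (T N).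
Hypothesis QE : forall N n, Q N [set n] = (harmonic_weight (T N) (c N) n)%:E.

Local Notation mom N k := (moment N (T N) (c N) k).

Lemma integral_log_ratio_moment N k : (1 < N)%N ->
  (\int[distribution (Q N) (log_ratio R N)]_x (`|x| ^+ k)%:E = (mom N k)%:E)%E.
Proof.
move=> N1; rewrite ge0_integral_distribution//=; last first.
  by apply/measurable_EFinP; apply: measurable_funX; exact: normr_measurable.
have [T0 Td Tp Tq] := T_ext N.
apply: (integral_harmonic_weight (QE N)) => [n|]; first by rewrite exprn_ge0.
have := cvg_moment (c0 N) T0 Td Tq N1 (sum_harmonic_weight_le1 (QE N)) (k := k).
apply: cvg_trans; apply: near_eq_cvg; apply: nearW => M.
rewrite /partial_moment; apply: eq_bigr => n _; rewrite addr0 ger0_norm//.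
apply: divr_ge0; last by rewrite ln_ge0// ler1n ltnW.
case: n => [|n]; first by rewrite ln0.
by rewrite ln_ge0// ler1n.
Qed.

Lemma moment0 N : (1 < N)%N -> mom N 0 = 1.
Proof.
move=> N1; apply/EFin_inj; rewrite -integral_log_ratio_moment//.
under eq_integral do rewrite expr0.
by rewrite integral_cst// mul1e; exact: probability_setT.
Qed.

(** In the size-bias comparison the masses of the shifts become uniform and the
    error tends to [0], so the recursion passes to the limit. *)
Lemma moment_cvg (a : nat -> R) (k : nat) : dickman_moments a ->
  mom N k @[N --> \oo] --> a k.
Proof.
move=> [a0 aS]; have [j] := ubnP k; elim: j => // j IH in k *; rewrite ltnS => kj.
case: k kj => [|k] kj.
  rewrite a0; apply: cvg_near_cst; near=> N; apply/moment0.
  by near: N; exact: nbhs_infty_gt.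
have {}IH i : (i <= k)%N -> mom N i @[N --> \oo] --> a i.
  by move=> ik; apply: IH; exact: leq_ltn_trans kj.
have [K K0 KP] := sum_higher_powers_bounded R k.
pose S N := \sum_(l < k.+1) mom N (k - l)%N *
  (\sum_(i < N) prime_weight R i / ln N%:R *
     (ln (nth_prime i.+1)%:R / ln N%:R) ^+ l) *+ 'C(k, l).
have SE : S N @[N --> \oo] --> a k.+1.
  rewrite aS; apply: cvg_finite_sum => l.
  under eq_fun do rewrite -mulr_natr; rewrite -mulr_natr.
  apply: cvgn_mul; last exact: cvg_cst.
  by apply: cvgn_mul; [exact/IH/leq_subr | exact: prime_weight_moment_asympt].
pose err N := (1 + K) * (\sum_(i < N) prime_weight R i / ln N%:R / (nth_prime i.+1)%:R) *
   \sum_(l < k.+1) mom N (k - l)%N * (2 * (ln (nth_prime N)%:R / ln N%:R)) ^+ l *+ 'C(k, l).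
have errE : err N @[N --> \oo] --> (0 : R).
  rewrite -[X in _ --> X](mul0r (\sum_(l < k.+1) a (k - l)%N * (2 * 1) ^+ l *+ 'C(k, l))).
  apply: cvgn_mul.
    rewrite -[X in _ --> X](mulr0 (1 + K)).
    by apply: cvgn_mul; [exact: cvg_cst | exact: prime_weight_error_asympt].
  apply: cvg_finite_sum => l.
  under eq_fun do rewrite -mulr_natr; rewrite -mulr_natr.
  apply: cvgn_mul; last exact: cvg_cst.
  apply: cvgn_mul; first exact/IH/leq_subr.
  by apply/cvgn_exp/cvgn_mul; [exact: cvg_cst | exact: ln_nth_prime_asympt].
have D : mom N k.+1 - S N @[N --> \oo] --> (0 : R).
  apply/norm_cvg0P; apply: squeeze_cvgr errE; last first.
    exact: cvg_cst.
  near=> N; rewrite normr_ge0/=.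
  have N1 : (1 < N)%N by near: N; exact: nbhs_infty_gt.
  have [T0 Td Tp Tq] := T_ext N.
  exact: (moment_size_bias (c0 N) T0 Td Tp Tq N1 (sum_harmonic_weight_le1 (QE N)) K0 KP).
have h : mom N k.+1 - S N + S N @[N --> \oo] --> 0 + a k.+1 by exact: cvgD.
rewrite add0r in h; apply: cvg_trans h; apply: near_eq_cvg.
by apply: nearW => N /=; rewrite subrK.
Unshelve. all: by end_near. Qed.

End moments_cvg.

(** * The Dickman function *)

Section dickman_function_theory.
Variables (R : realType) (rho : R -> R).
Hypothesis hrho : dickman_function rho.
Local Notation mu := (@lebesgue_measure R).

(** The extension of [rho] by [1] to the left, so that its primitive can be
    taken from a point left of the origin. *)
Definition dickman_ext (x : R) : R := if x <= 1 then 1 else rho x.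
Local Notation rb := dickman_ext.

Lemma dickman_extE x : 0 < x -> rb x = rho x.
Proof.
move=> x0; rewrite /rb; case: ifPn => // x1.
by have [_ -> //] := hrho; rewrite x0.
Qed.

Lemma continuous_dickman_ext : continuous rb.
Proof.
move=> x; have [x0|x0] := ltP 0 x.
  have [rc _ _] := hrho.
  have cx : {for x, continuous rho}.
    move: rc; rewrite continuous_open_subspace; last exact: interval_open.
    by apply; rewrite inE/= in_itv/= x0.
  rewrite /continuous_at dickman_extE//; apply: cvg_trans cx.
  apply: near_eq_cvg; near=> y; rewrite dickman_extE//.
  by near: y; exact: lt_nbhsr.
rewrite /continuous_at {2}/rb (le_trans x0 ler01); apply: cvg_near_cst.
near=> y; rewrite /rb ifT//; apply/ltW; near: y; apply: lt_nbhsl.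
exact: le_lt_trans x0 ltr01.
Unshelve. all: by end_near. Qed.

Lemma measurable_dickman_ext : measurable_fun [set: R] rb.
Proof. by apply: continuous_measurable_fun; exact: continuous_dickman_ext. Qed.

Lemma is_derive_dickman_ext (x : R) : 1 < x -> is_derive x 1 rb (- rb (x - 1) / x).
Proof.
move=> x1; have [_ _ /(_ x x1)[dr eq]] := hrho.
have x0 : 0 < x by exact: lt_trans x1.
have near_rb : \forall y \near x, rho y = rb y.
  near=> y; rewrite dickman_extE//; near: y; exact: lt_nbhsr.
have drb : derivable rb x 1 by exact: near_eq_derivable near_rb dr.
apply: DeriveDef => //.
rewrite -(@near_eq_derive R R R rho rb x 1 near_rb) -derive1E dickman_extE ?subr_gt0//.
apply: (mulfI (negbT (gt_eqF x0))); by rewrite [RHS]mulrC divfK ?gt_eqF//; lra.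
Unshelve. all: by end_near. Qed.

Definition dickman_primitive (x : R) : R := \int[mu]_(t in `[-1, x]) rb t.
Local Notation F := dickman_primitive.

Lemma is_derive_dickman_primitive (x : R) : -1 < x -> is_derive x 1 F (rb x).
Proof.
move=> x1; have [] := @continuous_FTC1_closed R rb (-1) x (x + 1) _ _ x1 _.
- by rewrite ltrDl.
- apply: continuous_compact_integrable; first exact: segment_compact.
  exact/continuous_subspaceT/continuous_dickman_ext.
- exact: continuous_dickman_ext.
by move=> dF; rewrite derive1E => FE; exact: (DeriveDef dF FE).
Qed.

Lemma dickman_primitive_MVT (a b : R) : -1 < a -> a < b ->
  exists2 c, a < c < b & F b - F a = rb c * (b - a).
Proof.
move=> a1 ab; have [c cab FE] : exists2 c, c \in `]a, b[%R & F b - F a = rb c * (b - a).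
  apply: MVT => // [x|].
    by rewrite in_itv/= => /andP[ax _]; apply: is_derive_dickman_primitive; exact: lt_trans ax.
  apply: derivable_within_continuous => x; rewrite in_itv/= => /andP[ax _].
  have := @is_derive_dickman_primitive x (lt_le_trans a1 ax).
  by move=> /@ex_derive.
by exists c => //; move: cab; rewrite in_itv.
Qed.

(** The delay equation in integrated form: the derivative of [x * rho x] is
    [rho x - rho (x - 1)]. *)
Lemma dickman_integral_equation x : 1 < x -> x * rb x = F x - F (x - 1).
Proof.
move=> x1; pose h : R -> R := fun y => y * rb y - F y + F (y - 1).
suff : h x - h 1 = 0.
  rewrite /h subrr mul1r => H.
  have [c /andP[_ c1]] := @dickman_primitive_MVT 0 1 (ltrN10 R) ltr01.
  rewrite {1}/rb (ltW c1) subr0 mulr1 => F01.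
  by move: H; rewrite {2}/rb lexx; lra.
have dh (y : R) : 1 < y -> is_derive y 1 h 0.
  move=> y1; have y0 : 0 < y by lra.
  have d1 := is_derive_dickman_ext y1.
  have d2 : is_derive y 1 F (rb y) by apply: is_derive_dickman_primitive; lra.
  have d3 : is_derive (y - 1) 1 F (rb (y - 1)) by apply: is_derive_dickman_primitive; lra.
  have d4 : is_derive y 1 (F \o (fun z => z - 1)) (rb (y - 1) * 1).
    by apply: is_derive1_comp; apply: is_derive_eq; rewrite subr0.
  have -> : h = (id * rb - F) + (F \o (fun z => z - 1)) by [].
  apply: is_derive_eq.
  have y0' : y != 0 by rewrite gt_eqF.
  by rewrite -![_ *: _]/(_ * _) /=; field.
have [] := @MVT R h (fun=> 0) 1 x x1.
- by move=> y; rewrite in_itv/= => /andP[hy _]; exact: dh.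
- apply: continuous_in_subspaceT => y; rewrite inE/= in_itv/= => /andP[hy _].
  have cF (z : R) : -1 < z -> {for z, continuous F}.
    move=> z1; apply/differentiable_continuous/derivable1_diffP.
    by have /@ex_derive := is_derive_dickman_primitive z1.
  apply: cvgD; last first.
    apply: (@cvg_comp _ _ _ (fun z : R => z - 1) F _ (nbhs (y - 1))).
      by apply: cvgB; [exact: cvg_id | exact: cvg_cst].
    by apply: cF; lra.
  apply: cvgB; last by apply: cF; lra.
  by apply: cvgM; [exact: cvg_id | exact: continuous_dickman_ext].
- by move=> c _ ->; rewrite mul0r.
Qed.

(** At a negative minimum [z], the integrated equation and the mean value theorem
    produce an earlier point of value [z * rho z], which is smaller still. *)
Lemma dickman_ext_ge0 x : 0 <= rb x.
Proof.
have [x1|x1] := leP x 1; first by rewrite /rb x1.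
rewrite leNgt; apply/negP => rx.
have [z zx zmin] := EVT_min (ltW x1) (continuous_subspaceT continuous_dickman_ext).
have rz : rb z < 0.
  by apply: le_lt_trans rx; apply: zmin; rewrite in_itv/= lexx ltW.
have z1 : 1 < z.
  by rewrite ltNge; apply/negP => z1; move: rz; rewrite /rb z1 ltr10.
have [c /andP[c1 cz]] : exists2 c, z - 1 < c < z & F z - F (z - 1) = rb c * (z - (z - 1)).
  by apply: dickman_primitive_MVT; lra.
rewrite -dickman_integral_equation// opprB addrCA subrr addr0 mulr1 => zc.
have rc : rb c < rb z by rewrite -zc; nra.
have [c1'|c1'] := leP c 1; first by move: rc; rewrite {1}/rb c1'; lra.
have : rb z <= rb c.
  apply: zmin; move: zx; rewrite !in_itv/= => /andP[_ zx].
  by rewrite (ltW c1') ltW// (lt_le_trans cz).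
by rewrite leNgt rc.
Qed.

Lemma integral_dickman_ext (a b : R) : -1 < a -> a < b ->
  (\int[mu]_(x in `[a, b]) (rb x)%:E = (F b - F a)%:E)%E.
Proof.
move=> a1 ab; rewrite (@continuous_FTC2 _ rb F)//.
- exact/continuous_subspaceT/continuous_dickman_ext.
- have cF (z : R) : -1 < z -> {for z, continuous F}.
    move=> z1; apply/differentiable_continuous/derivable1_diffP.
    by have /@ex_derive := is_derive_dickman_primitive z1.
  split.
  + move=> z; rewrite in_itv/= => /andP[az _].
    by have /@ex_derive := is_derive_dickman_primitive (lt_trans a1 az).
  + exact/cvg_at_right_filter/cF.
  + by apply/cvg_at_left_filter/cF; exact: lt_trans ab.
- move=> z; rewrite in_itv/= => /andP[az _].
  by rewrite derive1E; have /@derive_val := is_derive_dickman_primitive (lt_trans a1 az).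
Qed.

(** Up to normalization, [x * rho x] is the density of the sum of a variable of
    density [rho] and an independent uniform variable. *)
Lemma integral_dickman_window (x : R) : 0 < x ->
  (\int[mu]_(y in [set y : R | [&& 0 < y, x - 1 <= y & y <= x]%R]) (rb y)%:E =
   (x * rb x)%:E)%E.
Proof.
move=> x0; have [x1|x1] := leP x 1.
  have -> : [set y : R | [&& 0 < y, x - 1 <= y & y <= x]%R] = `]0, x]%classic.
    apply/seteqP; split=> y /=; rewrite in_itv/=; first by case/and3P => -> _ ->.
    by case/andP => y0 yx; rewrite y0 yx andbT/=; lra.
  rewrite integral_itv_obnd_cbnd; last first.
    by apply/measurable_EFinP; exact: measurable_funTS measurable_dickman_ext.
  rewrite (integral_dickman_ext (ltrN10 R) x0).
  have [c /andP[_ cx] ->] := dickman_primitive_MVT (ltrN10 R) x0.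
  by rewrite /rb x1 (le_trans (ltW cx))// subr0 mulrC.
have -> : [set y : R | [&& 0 < y, x - 1 <= y & y <= x]%R] = `[x - 1, x]%classic.
  apply/seteqP; split=> y /=; rewrite in_itv/=; first by case/and3P => _ -> ->.
  by case/andP => h1 h2; rewrite h1 h2 !andbT; lra.
by rewrite integral_dickman_ext -?dickman_integral_equation//; lra.
Qed.


(** The mean of [(y + u) ^ k] for [u] uniform in the unit interval. *)
Definition unit_window_mean (k : nat) (y : R) : R :=
  \sum_(l < k.+1) y ^+ (k - l) * l.+1%:R^-1 *+ 'C(k, l).

Lemma unit_window_meanE k y :
  unit_window_mean k y = ((y + 1) ^+ k.+1 - y ^+ k.+1) / k.+1%:R.
Proof.
rewrite exprDn big_ord_recl subn0 expr0 bin0 mulr1 mulr1n addrAC subrr add0r.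
rewrite mulr_suml; apply: eq_bigr => l _.
rewrite expr1n mulr1 lift0 subSS -[LHS]mulr_natr -[X in _ = X / _]mulr_natr.
rewrite -mulrA -[RHS]mulrA; congr (_ * _).
have l0 : l.+1%:R != 0 :> R by rewrite pnatr_eq0.
have k0 : k.+1%:R != 0 :> R by rewrite pnatr_eq0.
have : k.+1%:R * 'C(k, l)%:R = l.+1%:R * 'C(k.+1, l.+1)%:R :> R.
  by rewrite -!natrM mul_bin_diag.
move: (k.+1%:R) k0 (l.+1%:R) l0 => b b0 c0 d0 H.
by apply: (mulfI b0); rewrite mulrCA H mulKf// mulrC divfK.
Qed.

Lemma integral_power_window k (y : R) : 0 < y ->
  (\int[mu]_(x in [set x : R | [&& 0 < y, x - 1 <= y & y <= x]%R]) (`|x| ^+ k)%:E =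
   (unit_window_mean k y)%:E)%E.
Proof.
move=> y0.
have -> : [set x : R | [&& 0 < y, x - 1 <= y & y <= x]%R] = `[y, y + 1]%classic.
  apply/seteqP; split=> x /=; rewrite in_itv/=; first by case/and3P => _ h ->; lra.
  by case/andP => h1 h2; rewrite y0 h1 andbT/=; lra.
pose G : R -> R := fun x => x ^+ k.+1 / k.+1%:R.
have dG (x : R) : is_derive x 1 G (x ^+ k).
  have -> : G = k.+1%:R^-1 *: (id ^+ k.+1).
    by rewrite exprfctE; apply/funext => z; rewrite /G mulrC.
  apply: is_derive_eq.
  by rewrite -![_ *: _]/(_ * _) /= mulr1 mulKf.
transitivity (\int[mu]_(x in `[y, (y + 1)%R]) (x ^+ k)%:E)%E.
  apply: eq_integral => x; rewrite inE/= in_itv/= => /andP[yx _].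
  by rewrite ger0_norm// (le_trans (ltW y0)).
have cG (x : R) : {for x, continuous G}.
  by apply/differentiable_continuous/derivable1_diffP; have /@ex_derive := dG x.
rewrite (@continuous_FTC2 _ _ G).
- by rewrite unit_window_meanE /G -EFinB mulrBl.
- by rewrite ltrDl.
- exact/continuous_subspaceT/exprn_continuous.
- split.
  + by move=> x _; have /@ex_derive := dG x.
  + exact/cvg_at_right_filter/cG.
  + exact/cvg_at_left_filter/cG.
- by move=> x _; rewrite derive1E; have /@derive_val := dG x.
Qed.

(** Tonelli's theorem for [x ^ k * rho y] on the strip [x - 1 <= y <= x]:
    integrating over [y] first produces [x * rho x], integrating over [x] first
    produces the mean over a unit window. *)
Lemma dickman_size_bias k :
  (\int[mu]_(x in `]0%R, +oo[) (`|x| ^+ k.+1 * rb x)%:E =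
   \int[mu]_(y in `]0%R, +oo[) (unit_window_mean k `|y| * rb y)%:E)%E.
Proof.
pose S (x y : R) := [&& 0 < y, x - 1 <= y & y <= x].
pose f (z : R * R) : \bar R :=
  (if S z.1 z.2 then `|z.1| ^+ k * rb z.2 else 0)%:E.
have f0 z : (0 <= f z)%E.
  by rewrite lee_fin; case: ifP => // _; rewrite mulr_ge0 ?exprn_ge0 ?dickman_ext_ge0.
have m1 : measurable_fun [set: R * R] (fst : R * R -> R) by exact: measurable_fst.
have m2 : measurable_fun [set: R * R] (snd : R * R -> R) by exact: measurable_snd.
have mf : measurable_fun [set: R * R] f.
  apply/measurable_EFinP; apply: measurable_fun_ifT => //.
    apply: measurable_and; first exact: measurable_fun_ltr.
    apply: measurable_and; last exact: measurable_fun_ler.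
    by apply: measurable_fun_ler => //; exact: measurable_funB.
  apply: measurable_funM.
    by apply: measurable_funX; exact: measurableT_comp.
  exact: measurableT_comp measurable_dickman_ext m2.
have := fubini_tonelli (m1 := mu) (m2 := mu) f mf f0.
have -> : (\int[mu]_x \int[mu]_y f (x, y) =
    \int[mu]_(x in `]0%R, +oo[) (`|x| ^+ k.+1 * rb x)%:E)%E.
  rewrite [RHS]integral_mkcond; apply: eq_integral => x _; rewrite patchE.
  case: ifPn => [|/negP x0]; last first.
    rewrite integral0_eq// => y _; rewrite /f/= ifF//.
    apply/negP => /and3P[y0 _ yx]; apply: x0; rewrite inE/= in_itv/= andbT.
    exact: lt_le_trans yx.
  rewrite inE/= in_itv/= andbT => x0.
  transitivity ((`|x| ^+ k)%:E * \int[mu]_(y in [set y : R | S x y]) (rb y)%:E)%E; last first.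
    by rewrite integral_dickman_window// -EFinM exprSr -!mulrA (ger0_norm (ltW x0)).
  rewrite -ge0_integralZl//=; last 3 first.
  - rewrite (_ : [set y | S x y] = `]0, +oo[%classic `&` `[x - 1, x]%classic).
      exact: measurableI.
    by apply/seteqP; split=> y /=; rewrite !in_itv/= andbT => /andP.
  - by apply/measurable_EFinP; exact: measurable_funTS measurable_dickman_ext.
  - by move=> y _; rewrite lee_fin dickman_ext_ge0.
  rewrite [RHS]integral_mkcond; apply: eq_integral => y _; rewrite patchE /f/=.
  have -> : (y \in [set y : R | S x y]) = S x y by apply/idP/idP; rewrite inE.
  by case: ifP; rewrite ?EFinM.
move=> ->.
rewrite [RHS]integral_mkcond; apply: eq_integral => y _; rewrite patchE.
case: ifPn => [|/negP y0]; last first.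
  rewrite integral0_eq// => x _; rewrite /f/= ifF//.
  by apply/negP => /and3P[y0' _ _]; apply: y0; rewrite inE/= in_itv/= andbT.
rewrite inE/= in_itv/= andbT => y0.
transitivity (\int[mu]_(x in [set x : R | S x y]) (`|x| ^+ k)%:E * (rb y)%:E)%E; last first.
  by rewrite integral_power_window// -EFinM (ger0_norm (ltW y0)).
rewrite muleC -ge0_integralZl//=; last 3 first.
- rewrite (_ : [set x | S x y] = `[y, y + 1]%classic).
    by [].
  apply/seteqP; split=> x /=; rewrite in_itv/=; first by case/and3P => _ h ->; lra.
  by case/andP => h1 h2; rewrite /S y0 h1 andbT/=; lra.
- by apply/measurable_EFinP/measurable_funX; exact: normr_measurable.
- by rewrite lee_fin dickman_ext_ge0.
rewrite [RHS]integral_mkcond; apply: eq_integral => x _; rewrite patchE /f/=.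
have -> : (x \in [set x : R | S x y]) = S x y by apply/idP/idP; rewrite inE.
by case: ifP => // _; rewrite mulrC EFinM.
Qed.

End dickman_function_theory.

(** * The Dickman distribution *)

Section density.
Local Open Scope ereal_scope.

(** The Radon-Nikodym derivative is determined almost everywhere by the
    integrals over measurable sets, so it is [g]. *)
Lemma ge0_integral_density d (T : measurableType d) (R : realType)
    (mu : {sigma_finite_measure set T -> \bar R})
    (nu : {finite_measure set T -> \bar R}) (g : T -> \bar R) :
    measurable_fun [set: T] g -> (forall x, 0 <= g x) ->
    (forall A, measurable A -> nu A = \int[mu]_(x in A) g x) ->
  forall f : T -> \bar R, measurable_fun [set: T] f -> (forall x, 0 <= f x) ->
    \int[nu]_x f x = \int[mu]_x (f x * g x).
Proof.
move=> mg g0 nuE f mf f0.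
have numu : nu `<< mu.
  apply/null_content_dominatesP => A mA A0; rewrite nuE//.
  by apply: null_set_integral => //; exact: measurable_funTS.
rewrite -(Radon_Nikodym_SigmaFinite.change_of_variables numu)//.
have mh := measurable_int _ (Radon_Nikodym_SigmaFinite.f_integrable numu).
apply: ge0_ae_eq_integral => //.
- exact: emeasurable_funM.
- exact: emeasurable_funM.
- by move=> x _; rewrite mule_ge0// Radon_Nikodym_SigmaFinite.f_ge0.
- by move=> x _; rewrite mule_ge0.
apply: ae_eqe_mul2l; apply: integral_ae_eq => //.
  exact: Radon_Nikodym_SigmaFinite.f_integrable.
by move=> A _ mA; rewrite -Radon_Nikodym_SigmaFinite.f_integral// nuE.
Qed.

End density.

Section dickman_distribution_moments.
Variables (R : realType) (D : probability R R).
Hypothesis hD : dickman_distribution D.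

(** Lebesgue measure lives on a copy of [R] carrying the same Borel sets. *)
Let idR : R -> measurableTypeR R := idfun.

#[local] HB.instance Definition _ :=
  @isMeasurableFun.Build _ _ _ _ idR (@measurable_id _ _ setT).

Let dickman_integralE : exists (c : R) (rho : R -> R),
  [/\ 0 <= c, dickman_function rho &
    forall f : R -> \bar R, measurable_fun [set: R] f -> (forall x, 0 <= f x)%E ->
    (\int[D]_x f x =
     c%:E * \int[lebesgue_measure]_(x in `]0%R, +oo[) (f x * (dickman_ext rho x)%:E))%E].
Proof.
have [rho hrho DE] := hD; exists (expR (- euler_gamma R)), rho; split => //.
move=> f mf f0.
pose c := expR (- euler_gamma R); have c0 : 0 <= c by exact: expR_ge0.
pose g : R -> \bar R := (fun x => (c * dickman_ext rho x)%:E) \_ `]0, +oo[.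
have mrb := measurable_dickman_ext hrho.
have rb0 := dickman_ext_ge0 hrho.
have mcrb : measurable_fun [set: R] (fun x => (c * dickman_ext rho x)%:E).
  by apply/measurable_EFinP; exact: measurable_funM.
have mg : measurable_fun [set: R] g.
  apply/(measurable_restrictT _ (measurable_itv _)); exact: measurable_funTS.
have g0 x : (0 <= g x)%E.
  by rewrite /g patchE; case: ifP => // _; rewrite lee_fin mulr_ge0.
transitivity (\int[lebesgue_measure]_x (f x * g x))%E.
  rewrite -(@ge0_integral_distribution _ _ _ (measurableTypeR R) R D idR f)//.
  apply: (@ge0_integral_density _ (measurableTypeR R) R lebesgue_measure
    (distribution D idR) g) => // A mA.
  transitivity (D A) => //.
  rewrite DE// integral_mkcondr; apply: eq_integral => x _.
  rewrite /g !patchE; case: ifPn => //; rewrite inE/= in_itv/= andbT => x0.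
  by rewrite dickman_extE.
rewrite -ge0_integralZl//=.
- rewrite [RHS]integral_mkcond; apply: eq_integral => x _.
  rewrite /g !patchE; case: ifP => _; last by rewrite mule0.
  by rewrite EFinM muleCA.
- apply: emeasurable_funM; first exact: measurable_funTS.
  by apply/measurable_EFinP; exact: measurable_funTS.
- by move=> x _; rewrite mule_ge0// lee_fin.
Qed.

Lemma measurable_norm_power k : measurable_fun [set: R] (fun x : R => (`|x| ^+ k)%:E).
Proof. by apply/measurable_EFinP/measurable_funX; exact: normr_measurable. Qed.

(** The normalizing constant of the density is a common factor of both sides of
    the size-bias identity. *)
Lemma dickman_moment_recursion k :
  (\int[D]_x (`|x| ^+ k.+1)%:E =
   \sum_(l < k.+1) (l.+1%:R^-1 *+ 'C(k, l))%:E * \int[D]_x (`|x| ^+ (k - l))%:E)%E.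
Proof.
have [c [rho [c0 hrho E]]] := dickman_integralE.
transitivity (\int[D]_x (unit_window_mean k `|x|)%:E)%E.
  have ge0q (x : R) : 0 <= unit_window_mean k `|x| :> R.
    by apply: sumr_ge0 => l _; rewrite mulrn_wge0// mulr_ge0 ?exprn_ge0.
  have mq : measurable_fun [set: R] (fun x : R => (unit_window_mean k `|x|)%:E).
    apply/measurable_EFinP; apply: measurable_sum => l.
    under eq_fun do rewrite -mulrnAr.
    by apply: measurable_funM => //; apply: measurable_funX; exact: normr_measurable.
  rewrite !E//; last exact: measurable_norm_power.
  congr (_ * _)%E.
  under eq_integral do rewrite -EFinM; under [RHS]eq_integral do rewrite -EFinM.
  exact: dickman_size_bias.
have w0 l : 0 <= l.+1%:R^-1 *+ 'C(k, l) :> R by rewrite mulrn_wge0.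
transitivity (\int[D]_x (\sum_(l < k.+1)
    ((l.+1%:R^-1 *+ 'C(k, l))%:E * (`|x| ^+ (k - l))%:E)%E)%E)%E.
  apply: eq_integral => x _; under [RHS]eq_bigr do rewrite -EFinM.
  rewrite sumEFin; congr (_%:E).
  by apply: eq_bigr => l _; rewrite mulrnAl mulrC.
rewrite ge0_integral_sum//=; last first.
  by move=> l; apply: measurable_funeM; exact: measurable_norm_power.
apply: eq_bigr => l _; rewrite ge0_integralZl//.
exact: measurable_norm_power.
Qed.

(** The recursion makes every moment finite, starting from the total mass. *)
Lemma dickman_distribution_moments : exists2 a : nat -> R, dickman_moments a &
  forall k, (\int[D]_x (`|x| ^+ k)%:E = (a k)%:E)%E.
Proof.
pose M k := (\int[D]_x (`|x| ^+ k)%:E)%E.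
have M0 : M 0%N = 1%E.
  rewrite /M; under eq_integral do rewrite expr0.
  by rewrite integral_cst// mul1e; exact: probability_setT.
have fM k : M k \is a fin_num.
  have [j] := ubnP k; elim: j => // j IH in k *; rewrite ltnS.
  case: k => [|k] kj; first by rewrite M0.
  rewrite /M dickman_moment_recursion; apply/sum_fin_numP => l _ _.
  by rewrite fin_numM// IH// (leq_ltn_trans (leq_subr _ _)).
exists (fine \o M) => [|k]; last by rewrite /= fineK.
split=> [|k]; first by rewrite /= M0.
apply/EFin_inj; rewrite /= fineK// {1}/M dickman_moment_recursion -sumEFin.
apply: eq_bigr => l _; rewrite -/(M (k - l)%N) -[X in (_ * X)%E](fineK (fM _)) -EFinM.
by congr (_%:E); rewrite mulrnAl mulrC.
Qed.

End dickman_distribution_moments.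

(** * Alternating Taylor bounds for the exponential *)

Section exponential_taylor.
Variable R : realType.

Definition expN_taylor (K : nat) (t : R) : R := \sum_(k < K) (- t) ^+ k / k`!%:R.

Let is_derive_expN_taylor K (t : R) :
  is_derive t 1 (expN_taylor K.+1) (- expN_taylor K t).
Proof.
elim: K => [|K IH].
  have -> : expN_taylor 1 = cst 1.
    by apply/funext => z; rewrite /expN_taylor big_ord1 expr0 fact0 divr1.
  by rewrite /expN_taylor big_ord0 oppr0; exact: is_derive_cst.
pose c : R := (-1) ^+ K.+1 / (K.+1)`!%:R.
have -> : expN_taylor K.+2 = expN_taylor K.+1 + c *: (id ^+ K.+1).
  apply/funext => z; rewrite /expN_taylor big_ord_recr/=; congr (_ + _).
  by rewrite exprfctE exprNn mulrAC.
have d1 : is_derive t 1 (c *: (id ^+ K.+1)) (c * (K.+1%:R * t ^+ K)).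
  apply: is_derive_eq.
  by rewrite -![_ *: _]/(_ * _) /= mulr1.
apply: is_derive_eq (is_deriveD IH d1) _.
rewrite {2}/expN_taylor big_ord_recr/= opprD; congr (_ + _).
rewrite /c factS natrM [(- t) ^+ K]exprNn exprS.
have f0 : K`!%:R != 0 :> R by rewrite pnatr_eq0 -lt0n fact_gt0.
have k0 : K.+1%:R != 0 :> R by rewrite pnatr_eq0.
move: (K.+1%:R) k0 (K`!%:R) f0 ((-1) ^+ K) (t ^+ K) => a a0 b b0 y z; field.
by rewrite a0 b0.
Qed.

(** The remainders alternate in sign: each is the antiderivative, vanishing at
    the origin, of the opposite of the preceding one. *)
Lemma expN_taylor_sign K (t : R) : 0 <= t ->
  0 <= (-1) ^+ K * (expR (- t) - expN_taylor K t).
Proof.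
elim: K t => [|K IH] t t0.
  by rewrite expr0 mul1r /expN_taylor big_ord0 subr0 expR_ge0.
pose h (s : R) := (-1) ^+ K.+1 * (expR (- s) - expN_taylor K.+1 s).
have dh (s : R) : is_derive s 1 h ((-1) ^+ K * (expR (- s) - expN_taylor K s)).
  have d1 : is_derive s 1 (expR \o -%R) (expR (- s) * -1).
    by apply: is_derive1_comp.
  have d2 := is_derive_expN_taylor K s.
  have -> : h = (-1) ^+ K.+1 *: ((expR \o -%R) - expN_taylor K.+1) by [].
  apply: is_derive_eq.
  by rewrite -![_ *: _]/(_ * _) exprS; ring.
have h0 : h 0 = 0.
  rewrite /h oppr0 expR0 /expN_taylor big_ord_recl expr0 fact0 divr1 big1.
    by rewrite addr0 subrr mulr0.
  by move=> k _; rewrite oppr0 expr0n lift0 mul0r.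
case: (eqVneq t 0) => [->|tn0]; first by rewrite -/(h 0) h0.
have t0' : 0 < t by rewrite lt_def tn0.
have [|c + hE] := @MVT R h _ 0 t t0' (fun s _ => dh s).
  apply: continuous_subspaceT => s.
  by apply/differentiable_continuous/derivable1_diffP; have /@ex_derive := dh s.
rewrite in_itv/= => /andP[c0 _]; move: hE; rewrite h0 !subr0 -/(h t) => ->.
by rewrite mulr_ge0// IH// ltW.
Qed.

(** Two consecutive remainders of opposite signs differ by the term in between. *)
Lemma expN_taylor_bound K (t : R) : 0 <= t ->
  `|expR (- t) - expN_taylor K t| <= t ^+ K / K`!%:R.
Proof.
move=> t0; have h1 := expN_taylor_sign K t0; have h2 := expN_taylor_sign K.+1 t0.
have -> : `|expR (- t) - expN_taylor K t| = (-1) ^+ K * (expR (- t) - expN_taylor K t).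
  by rewrite -[RHS](ger0_norm h1) normrM normrX normrN1 expr1n mul1r.
have zq : (-1) ^+ K * ((- t) ^+ K / K`!%:R) = t ^+ K / K`!%:R.
  by rewrite mulrA -exprMn mulN1r opprK.
rewrite -zq -subr_ge0; apply: le_trans h2 _.
rewrite exprS {1}/expN_taylor big_ord_recr/= -/(expN_taylor K t).
by rewrite le_eqVlt; apply/orP; left; apply/eqP; ring.
Qed.

End exponential_taylor.

(** * Uniform approximation by Bernstein polynomials *)

Section weierstrass.
Variable R : realType.

(** Bernstein polynomials by the recursion of the number of successes in [n]
    Bernoulli trials: the first trial fails with probability [1 - x]. *)
Fixpoint bernstein (n : nat) (phi : nat -> R) : {poly R} :=
  if n is n'.+1 then
    (1 - 'X) * bernstein n' phi + 'X * bernstein n' (fun k => phi k.+1)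
  else (phi 0%N)%:P.

(** The factor of [C] on the right is the second moment about [c] of a binomial
    variable, which obeys the same recursion. *)
Lemma bernstein_approx n phi (y A C b c : R) : 0 <= y <= 1 ->
    (forall k, (k <= n)%N -> `|(phi k) - b| <= A + C * (k%:R - c) ^+ 2) ->
  `|(bernstein n phi).[y] - b| <=
    A + C * (n%:R * y * (1 - y) + (n%:R * y - c) ^+ 2).
Proof.
move=> y01; elim: n phi c => [|n IH] phi c h.
  by rewrite /= hornerC !mul0r add0r; exact: (h 0%N).
have y0 : 0 <= y by case/andP: y01.
have y1 : 0 <= 1 - y by case/andP: y01; lra.
rewrite /= !hornerE.
have h1 := IH phi c (fun k kn => h k (leqW kn)).
have h2 : `|(bernstein n (fun k => phi k.+1)).[y] - b| <=
    A + C * (n%:R * y * (1 - y) + (n%:R * y - (c - 1)) ^+ 2).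
  apply: IH => k kn; apply: le_trans (h k.+1 kn) _.
  by rewrite -natr1 (_ : k%:R - (c - 1) = k%:R + 1 - c)//; ring.
move: h1 h2; set B1 := (bernstein n phi).[y]; set B2 := horner _ _ => h1 h2.
have -> : (1 - y) * B1 + y * B2 - b = (1 - y) * (B1 - b) + y * (B2 - b) by ring.
apply: le_trans (ler_normD _ _) _; rewrite !normrM (ger0_norm y0) (ger0_norm y1).
apply: le_trans (lerD (ler_wpM2l y1 h1) (ler_wpM2l y0 h2)) _.
rewrite -natr1 le_eqVlt; apply/orP; left; apply/eqP; ring.
Qed.

Lemma segment_unif_continuous (g : R -> R) (a b e : R) : continuous g -> 0 < e ->
  exists2 d : R, 0 < d & forall x y, a <= x <= b -> `|y - x| < d -> `|g y - g x| <= e.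
Proof.
move=> cg e0.
have /compact_near_coveringP cov := @segment_compact R a b.
have : \forall d \near (0 : R)^'+, `[a, b]%classic `<=`
    [set x | forall y, `|y - x| < d -> `|g y - g x| <= e].
  apply: cov => x _.
  have e2 : 0 < e / 2 by rewrite divr_gt0.
  have /cvgrPdist_le /(_ _ e2) /nbhs_ballP[r /= r0 hr] := cg x.
  exists (ball x (r / 2), [set d : R | d < r / 2]) => /=.
    split; first by apply: nbhsx_ballx; rewrite divr_gt0.
    by apply: nbhs_right_lt; rewrite divr_gt0.
  move=> [x' d] /= [xx' dr] y yd.
  have r0' : 0 < r by [].
  have xx2 : `|x - x'| < r / 2 by [].
  have d2 : d < r / 2 by [].
  have gx' : `|g x - g x'| <= e / 2.
    by apply: hr; rewrite /ball/=; lra.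
  have gy : `|g x - g y| <= e / 2.
    apply: hr; rewrite /ball/=.
    have := ler_distD x' x y; rewrite (distrC x' y); lra.
  have := ler_distD (g x) (g y) (g x'); rewrite (distrC (g y) (g x)); lra.
move=> cov'; have : \forall d \near (0 : R)^'+, 0 < d by exact: nbhs_right_gt.
move=> /(filterI cov') /filter_ex[d [h d0]]; exists d => // x y xab.
by apply: h; rewrite /= in_itv.
Qed.

(** Chebyshev's argument: [g (k / n)] is within [e / 2] of [g y] unless [k / n] is
    farther than [d] from [y], and then the difference is at most
    [2 * M * ((k / n - y) / d) ^ 2], of binomial mean [O (1 / n)]. *)
Lemma weierstrass_unit (g : R -> R) (M e : R) : continuous g -> 0 < e ->
    (forall y, 0 <= y <= 1 -> `|g y| <= M) ->
  exists p : {poly R}, forall y, 0 <= y <= 1 -> `|p.[y] - g y| <= e.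
Proof.
move=> cg e0 gM; have e2 : 0 < e / 2 by rewrite divr_gt0.
have M0 : 0 <= M by apply: le_trans (gM 0 _); rewrite ?lexx ?ler01.
have [d d0 hd] := segment_unif_continuous 0 1 cg e2.
pose n := (Num.trunc (M / d ^+ 2 / e)).+1.
have n0 : 0 < n%:R :> R by rewrite ltr0n.
have nM : M / d ^+ 2 <= n%:R * e.
  by rewrite -ler_pdivrMr// ltW// truncnS_gt.
exists (bernstein n (fun k => g (k%:R / n%:R))) => y y01.
pose C := 2 * M / d ^+ 2 / n%:R ^+ 2.
have C0 : 0 <= C by rewrite !divr_ge0 ?exprn_ge0 ?mulr_ge0 ?(ltW d0)// ltW.
apply: le_trans (@bernstein_approx n _ y (e / 2) C (g y) (n%:R * y) y01 _) _.
  move=> k kn; have k01 : 0 <= (k%:R / n%:R : R) <= 1.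
    by rewrite divr_ge0//= ler_pdivrMr// mul1r ler_nat.
  have sq : C * (k%:R - n%:R * y) ^+ 2 = 2 * M * ((k%:R / n%:R - y) / d) ^+ 2.
    by rewrite /C; field; rewrite !gt_eqF.
  have [kd|kd] := ltP `|k%:R / n%:R - y| d.
    rewrite (le_trans (hd _ _ y01 kd))// lerDl mulr_ge0// sqr_ge0//.
  rewrite (le_trans (ler_normB _ _))//.
  have h1 := gM _ k01; have h2 := gM _ y01.
  have : 1 <= ((k%:R / n%:R - y) / d) ^+ 2.
    rewrite -real_normK ?num_real// normrM normfV (gtr0_norm d0).
    by rewrite exprn_ege1// ler_pdivlMr// mul1r.
  rewrite sq; move: (_ ^+ 2) => z z1.
  have : 2 * M * 1 <= 2 * M * z by rewrite ler_wpM2l// mulr_ge0.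
  lra.
rewrite subrr expr0n addr0.
have y4 : y * (1 - y) <= 4^-1 by have h := sqr_ge0 (y - 2^-1 : R); rewrite expr2 in h; lra.
have y40 : 0 <= y * (1 - y) by case/andP: y01 => *; rewrite mulr_ge0// subr_ge0.
have : C * (n%:R * y * (1 - y)) <= M / d ^+ 2 / n%:R / 2.
  rewrite [leLHS](_ : _ = M / d ^+ 2 / n%:R * (2 * (y * (1 - y)))); last first.
    by rewrite /C; field; rewrite !gt_eqF.
  rewrite ler_wpM2l ?divr_ge0 ?exprn_ge0 ?(ltW d0) ?(ltW n0)//; lra.
have : M / d ^+ 2 / n%:R <= e by rewrite ler_pdivrMr// [e * _]mulrC.
lra.
Qed.

End weierstrass.

(** * The method of moments on the half-line *)

Section moment_integrals.
Variables (R : realType) (nu : probability R R) (b : nat -> R).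
Hypothesis bE : forall k, (\int[nu]_x (`|x| ^+ k)%:E = (b k)%:E)%E.
Local Notation integrable f := (nu.-integrable [set: R] (EFin \o f)).

Lemma integrable_bounded (f : R -> R) (M : R) : measurable_fun [set: R] f ->
  (forall x, `|f x| <= M) -> integrable f.
Proof.
move=> mf fM; apply: (le_integrable _ _ _ (finite_measure_integrable_cst nu M measurableT)) => //.
  exact/measurable_EFinP.
by move=> x _ /=; rewrite lee_fin (le_trans (fM x))// ler_norm.
Qed.

Lemma integrable_norm_power k : integrable (fun x => `|x| ^+ k).
Proof.
apply/integrableP; split; first exact: measurable_norm_power.
rewrite (eq_integral (fun x : R => (`|x| ^+ k)%:E)).
  by rewrite bE ltry.
by move=> x _ /=; rewrite ger0_norm// exprn_ge0.
Qed.

Lemma Rintegral_norm_power k : \int[nu]_x (`|x| ^+ k) = b k.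
Proof. by rewrite /Rintegral bE. Qed.

Lemma norm_Rintegral_sub_le (u v h : R -> R) :
  integrable u -> integrable v -> integrable h ->
  (forall x, `|u x - v x| <= h x) ->
  `|\int[nu]_x u x - \int[nu]_x v x| <= \int[nu]_x h x.
Proof.
move=> iu iv ih uvh; have iuv : integrable (fun x => u x - v x).
  exact: (integrableB measurableT iu iv).
rewrite -RintegralB//; apply: le_trans (le_normr_Rintegral measurableT iuv) _.
apply: le_Rintegral => //.
apply: (le_integrable _ _ _ ih) => //.
  by apply/measurable_EFinP/measurableT_comp => //; apply/measurable_EFinP; case/integrableP : iuv.
move=> x _ /=; rewrite lee_fin normr_id (le_trans (uvh x))//.
exact: ler_norm.
Qed.

Lemma Rintegral_finite_sum (I : Type) (s : seq I) (f : I -> R -> R) :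
    (forall i, integrable (f i)) ->
  integrable (fun x => \sum_(i <- s) f i x) /\
  \int[nu]_x (\sum_(i <- s) f i x) = \sum_(i <- s) \int[nu]_x f i x.
Proof.
move=> fi; elim: s => [|i s [IH1 IH2]].
  under eq_fun do rewrite big_nil; split.
    exact: (finite_measure_integrable_cst nu 0 measurableT).
  rewrite big_nil -[RHS](mul0r (fine (nu [set: R]))) -Rintegral_cst//.
under eq_fun do rewrite big_cons; split; first exact: (integrableD measurableT (fi i) IH1).
by rewrite big_cons -IH2 -RintegralD.
Qed.

(** With [|x|] in place of [x] the estimates hold on the whole line; for a law
    carried by the half-line this is the usual Laplace transform. *)
Definition abs_laplace (s : R) : R := \int[nu]_x expR (- (s * `|x|)).

Lemma integrable_abs_laplace s : 0 <= s -> integrable (fun x => expR (- (s * `|x|))).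
Proof.
move=> s0; apply: (@integrable_bounded _ 1).
  apply: measurableT_comp => //; apply: measurableT_comp => //.
  by apply: measurable_funM => //; exact: normr_measurable.
by move=> x; rewrite ger0_norm ?expR_ge0// -expR0 ler_expR oppr_le0 mulr_ge0.
Qed.

Lemma abs_laplace_taylor K s : 0 <= s ->
  `|abs_laplace s - \sum_(k < K) (- s) ^+ k / k`!%:R * b k| <= s ^+ K / K`!%:R * b K.
Proof.
move=> s0; have i1 k (c : R) : integrable (fun x => c * `|x| ^+ k).
  exact: (integrableZl measurableT c (integrable_norm_power k)).
have [i2 E] := Rintegral_finite_sum (index_enum 'I_K)
  (fun k : 'I_K => i1 k ((- s) ^+ k / k`!%:R)).
have -> : \sum_(k < K) (- s) ^+ k / k`!%:R * b k =
    \int[nu]_x (\sum_(k < K) (- s) ^+ k / k`!%:R * `|x| ^+ k).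
  rewrite E; apply: eq_bigr => k _.
  by rewrite RintegralZl ?Rintegral_norm_power//; exact: integrable_norm_power.
rewrite -Rintegral_norm_power -RintegralZl//; last exact: integrable_norm_power.
apply: norm_Rintegral_sub_le => //; first exact: integrable_abs_laplace.
move=> x; have sx : 0 <= s * `|x| by rewrite mulr_ge0.
have := expN_taylor_bound K sx; rewrite /expN_taylor exprMn mulrAC.
rewrite [X in `|_ - X| <= _ -> _](_ : _ = \sum_(k < K) (- s) ^+ k / k`!%:R * `|x| ^+ k)//.
by apply: eq_bigr => k _; rewrite -mulNr exprMn mulrAC.
Qed.

(** A polynomial in [exp (- d |x|)] has an integral determined by the values of
    the Laplace transform at the multiples of [d]. *)
Lemma Rintegral_poly_laplace (p : {poly R}) d : 0 <= d ->
  integrable (fun x => p.[expR (- (d * `|x|))]) /\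
  \int[nu]_x p.[expR (- (d * `|x|))] =
    \sum_(i < size p) p`_i * abs_laplace (i%:R * d).
Proof.
move=> d0; have i1 k : integrable (fun x => expR (- (k%:R * d * `|x|))).
  by apply: integrable_abs_laplace; rewrite mulr_ge0.
have i2 (k : nat) (c : R) : integrable (fun x => c * expR (- (k%:R * d * `|x|))).
  exact: (integrableZl measurableT c (i1 k)).
have [i3 E] := Rintegral_finite_sum (index_enum 'I_(size p))
  (fun k : 'I_(size p) => i2 k p`_k).
have pE x : p.[expR (- (d * `|x|))] =
    \sum_(i < size p) p`_i * expR (- (i%:R * d * `|x|)).
  rewrite horner_coef; apply: eq_bigr => i _; congr (_ * _).
  by rewrite -expRM_natl mulrN mulrA.
split; first by rewrite (_ : (fun x => _) = (fun x =>
    \sum_(i < size p) p`_i * expR (- (i%:R * d * `|x|))))//; apply/funext.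
under eq_Rintegral do rewrite pE.
by rewrite E; apply: eq_bigr => k _; rewrite RintegralZl.
Qed.

End moment_integrals.

Section method_of_moments.
Variables (R : realType) (mu_ : nat -> probability R R) (mu : probability R R).
Variables (b_ : nat -> nat -> R) (b : nat -> R) (N0 : nat).
Hypothesis mu_neg : forall N, mu_ N [set x : R | x < 0] = 0%E.
Hypothesis mu_neg0 : mu [set x : R | x < 0] = 0%E.
Hypothesis b_E : forall N k, (N0 < N)%N -> (\int[mu_ N]_x (`|x| ^+ k)%:E = (b_ N k)%:E)%E.
Hypothesis bE : forall k, (\int[mu]_x (`|x| ^+ k)%:E = (b k)%:E)%E.
Hypothesis b_cvg : forall k, b_ N k @[N --> \oo] --> b k.
Hypothesis b_small : forall s, 0 <= s -> s ^+ k / k`!%:R * b k @[k --> \oo] --> (0 : R).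

(** The expansion to order [K] leaves an error bounded by a single moment term,
    which is small for the limit law and hence eventually for the sequence. *)
Lemma abs_laplace_cvg s : 0 <= s ->
  abs_laplace (mu_ N) s @[N --> \oo] --> abs_laplace mu s.
Proof.
move=> s0; apply/cvgrPdist_le => e e0.
have e4 : 0 < e / 4 by rewrite divr_gt0.
have [K _ HK] : \forall k \near \oo, `|0 - s ^+ k / k`!%:R * b k| <= e / 4.
  by move/cvgrPdist_le : (b_small s0); exact.
have {}HK : s ^+ K / K`!%:R * b K <= e / 4.
  have := HK K (leqnn K); rewrite /= sub0r normrN; exact/le_trans/ler_norm.
pose S N := \sum_(k < K) (- s) ^+ k / k`!%:R * b_ N k.
pose S0 := \sum_(k < K) (- s) ^+ k / k`!%:R * b k.
have SS : S N @[N --> \oo] --> S0.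
  by apply: cvg_finite_sum => k; apply: cvgn_mul; [exact: cvg_cst | exact: b_cvg].
have TT : s ^+ K / K`!%:R * b_ N K @[N --> \oo] --> s ^+ K / K`!%:R * b K.
  by apply: cvgn_mul; [exact: cvg_cst | exact: b_cvg].
near=> N.
have NN : (N0 < N)%N by near: N; exact: nbhs_infty_gt.
have h1 : `|S0 - S N| <= e / 4 by near: N; move/cvgrPdist_le : SS; exact.
have h2 : `|s ^+ K / K`!%:R * b K - s ^+ K / K`!%:R * b_ N K| <= e / 4.
  by near: N; move/cvgrPdist_le : TT; exact.
have h3 := abs_laplace_taylor (fun k => b_E k NN) K s0.
have h4 := abs_laplace_taylor bE K s0.
move: h1 h2 h3 h4 HK; rewrite -/(S N) -/S0 !ler_norml.
move=> /andP[? ?] /andP[? ?] /andP[? ?] /andP[? ?] ?.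
by apply/andP; split; lra.
Unshelve. all: by end_near. Qed.

Let integral_abs (nu : probability R R) (f : R -> R) (M : R) :
  nu [set x : R | x < 0] = 0%E -> continuous f -> (forall x, `|f x| <= M) ->
  (\int[nu]_x (f x)%:E = (\int[nu]_x f `|x|)%:E)%E.
Proof.
move=> nu0 cf fM; have mf := continuous_measurable_fun cf.
have mfa : measurable_fun [set: R] (fun x : R => f `|x|).
  by apply: measurableT_comp => //; exact: normr_measurable.
rewrite /Rintegral fineK; last first.
  by apply: integrable_fin_num => //; exact: integrable_bounded.
apply: ae_eq_integral => //; [exact/measurable_EFinP | exact/measurable_EFinP |].
exists [set x : R | x < 0]; split => //.
  by rewrite -set_itvNyo; exact: measurable_itv.
move=> x /= /not_implyP[_]; rewrite ltNge => H; apply/negP => x0; apply: H.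
by rewrite ger0_norm.
Qed.

(** For [x >= 0], [f x * exp (- d * x)] is a continuous function of the number
    [exp (- d * x)] of the unit interval, hence uniformly close to a polynomial in
    it; and it differs from [f x] by at most [M * d * x]. *)
Let poly_laplace_approx (f : R -> R) (M e : R) : continuous f ->
    (forall x, `|f x| <= M) -> 0 < e ->
  exists d, 0 < d /\ exists p : {poly R}, forall x : R,
    `|f `|x| - p.[expR (- (d * `|x|))]| <= e * `|x| + e.
Proof.
move=> cf fM e0; have M0 : 0 <= M by exact: le_trans (fM 0).
pose d := e / (M + 1); have d0 : 0 < d by rewrite divr_gt0// ltr_wpDl.
pose g (y : R) : R := if y <= 0 then 0 else f (- ln y / d) * y.
have gM (y : R) : 0 <= y -> `|g y| <= M * y.
  move=> y0; rewrite /g; case: ifPn => _; first by rewrite normr0 mulr_ge0.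
  by rewrite normrM (ger0_norm y0) ler_wpM2r.
have cg : continuous g.
  move=> y; have [y0|y0|y0] := ltgtP y 0.
  - rewrite /continuous_at {2}/g (ltW y0); apply: cvg_near_cst.
    near=> z; rewrite /g ifT//; apply: ltW; near: z; exact: lt_nbhsl.
  - have : (fun z => f (- ln z / d) * z) z @[z --> y] --> f (- ln y / d) * y.
      apply: cvgM; last exact: cvg_id.
      apply: (@cvg_comp _ _ _ (fun z => - ln z / d) f _ (nbhs (- ln y / d))); last exact: cf.
      apply: cvgM; last exact: cvg_cst.
      by apply: cvgN; exact: continuous_ln.
    rewrite /continuous_at {2}/g leNgt y0/=; apply: cvg_trans; apply: near_eq_cvg.
    near=> z; rewrite /g ifF//; apply/negbTE; rewrite -ltNge; near: z; exact: lt_nbhsr.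
  - rewrite y0 /continuous_at {2}/g lexx; apply/cvgrPdist_le => r r0.
    near=> z; rewrite sub0r normrN.
    have [z0|z0] := leP z 0; first by rewrite /g z0 normr0 ltW.
    rewrite (le_trans (gM z (ltW z0)))//.
    have : `|z| <= r / (M + 1).
      near: z; have /cvgrPdist_le := @cvg_id R (nbhs (0 : R)).
      move=> /(_ (r / (M + 1))); rewrite divr_gt0 ?ltr_wpDl// => /(_ isT).
      by apply: filterS => z; rewrite sub0r normrN.
    rewrite (gtr0_norm z0) ler_pdivlMr ?ltr_wpDl//; apply: le_trans; lra.
have [p hp] := @weierstrass_unit R g M e cg e0 (fun y hy =>
  le_trans (gM y (proj1 (andP hy))) (ler_piMr M0 (proj2 (andP hy)))).
exists d; split => //; exists p => x.
set y := expR _; have y0 : 0 < y by exact: expR_gt0.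
have t0 : 0 <= d * `|x| by rewrite mulr_ge0 ?(ltW d0).
have y1 : y <= 1 by rewrite -expR0 ler_expR oppr_le0.
have gy : g y = f `|x| * y.
  rewrite /g leNgt y0/= expRK opprK mulrAC divff ?mul1r// gt_eqF//.
have h1 : `|f `|x| - g y| <= e * `|x|.
  rewrite gy -{1}[f `|x|]mulr1 -mulrBr normrM.
  have : 1 - y <= d * `|x|.
    by have := expR_ge1Dx (- (d * `|x|)); rewrite -/y; lra.
  rewrite [`|1 - y|]ger0_norm ?subr_ge0// => h.
  apply: le_trans (ler_pM _ _ (fM _) h) _; rewrite ?subr_ge0//.
  rewrite mulrA ler_wpM2r// /d mulrCA ler_piMr ?(ltW e0)//.
  by rewrite ler_pdivrMr ?ltr_wpDl// mul1r; lra.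
have h2 := hp y; rewrite (ltW y0) y1 in h2; have {}h2 := h2 isT.
have := ler_distD (g y) (f `|x|) p.[y]; rewrite (distrC (g y)); lra.
Unshelve. all: by end_near. Qed.

(** The integral of the error [r * |x| + r] of the approximation by polynomials in
    [exp (- d * |x|)] is bounded through the first moments, uniformly along the
    sequence; the integrals of the polynomials converge. *)
Theorem weak_cvg_of_moments : weak_cvg mu_ mu.
Proof.
move=> f cf /pinfty_ex_gt0[M M0 hM].
have fM x : `|f x| <= M by exact: hM.
rewrite (integral_abs mu_neg0 cf fM).
under eq_fun do rewrite (integral_abs (mu_neg _) cf fM).
apply: cvg_EFin; first exact: nearW.
rewrite (_ : fine \o _ = fun N => \int[mu_ N]_x f `|x|); last exact/funext.
apply/cvgrPdist_le => e e0.
have iab (nu : probability R R) : nu.-integrable [set: R] (EFin \o (fun x => f `|x|)).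
  apply: (@integrable_bounded _ nu _ M) => [|x]; last exact: fM.
  apply: measurableT_comp; first exact: continuous_measurable_fun.
  exact: normr_measurable.
pose r := e / (4 * (`|b 1%N| + 2)).
have r0 : 0 < r by rewrite divr_gt0// mulr_gt0// ltr_wpDl.
have [d [d0 [p hp]]] := poly_laplace_approx cf fM r0.
have key (nu : probability R R) (c : nat -> R) :
    (forall k, (\int[nu]_x (`|x| ^+ k)%:E = (c k)%:E)%E) ->
    `|\int[nu]_x f `|x| - \int[nu]_x p.[expR (- (d * `|x|))]| <= r * c 1%N + r.
  move=> cE; have [ip _] := Rintegral_poly_laplace nu p (ltW d0).
  have i1 := integrable_norm_power cE 1.
  have i2 := integrableZl measurableT r i1.
  have i3 := finite_measure_integrable_cst nu r measurableT.
  have i4 := integrableD measurableT i2 i3.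
  apply: le_trans (norm_Rintegral_sub_le (iab nu) ip i4 _) _.
    by move=> x; rewrite /= expr1; exact: hp.
  rewrite RintegralD// RintegralZl// (Rintegral_norm_power cE) Rintegral_cst//.
  by rewrite (_ : fine _ = 1) ?mulr1//; exact: (congr1 fine (probability_setT nu)).
pose I (nu : probability R R) := \sum_(i < size p) p`_i * abs_laplace nu (i%:R * d).
have IE (nu : probability R R) : \int[nu]_x p.[expR (- (d * `|x|))] = I nu.
  by have [_ ->] := Rintegral_poly_laplace nu p (ltW d0).
have Icvg : I (mu_ N) @[N --> \oo] --> I mu.
  apply: cvg_finite_sum => i; apply: cvgn_mul; first exact: cvg_cst.
  by apply: abs_laplace_cvg; rewrite mulr_ge0// ltW.
have e4 : 0 < e / 4 by rewrite divr_gt0.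
near=> N.
have NN : (N0 < N)%N by near: N; exact: nbhs_infty_gt.
have h1 : `|I mu - I (mu_ N)| <= e / 4.
  by near: N; move/cvgrPdist_le : Icvg; exact.
have h2 : `|b 1%N - b_ N 1%N| <= 1.
  by near: N; move/cvgrPdist_le : (@b_cvg 1%N); exact.
have h3 := key (mu_ N) (b_ N) (fun k => b_E k NN).
have h4 := key _ _ bE.
rewrite !IE in h3 h4.
have rE : r * (`|b 1%N| + 2) = e / 4.
  rewrite /r invfM mulrA divfK// gt_eqF// ltr_wpDl//.
have h5 : r * b 1%N <= r * `|b 1%N| by rewrite ler_pM2l// ler_norm.
have h6 : r * b_ N 1%N <= r * (`|b 1%N| + 1).
  rewrite ler_pM2l//; move: h2; rewrite ler_norml => /andP[h2 _].
  by have := ler_norm (b 1%N); lra.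
have h7 := ler_distD (I mu) (\int[mu]_x f `|x|) (\int[mu_ N]_x f `|x|).
have h8 := ler_distD (I (mu_ N)) (I mu) (\int[mu_ N]_x f `|x|).
rewrite (distrC (I (mu_ N)) (\int[mu_ N]_x f `|x|)) in h8.
lra.
Unshelve. all: by end_near. Qed.

End method_of_moments.

(** * Growth of the Dickman moments *)

Section dickman_moment_growth.
Variables (R : realType) (a : nat -> R).
Hypothesis a_rec : dickman_moments a.

Let a_ge0 k : 0 <= a k.
Proof.
have [a0 aS] := a_rec; have [j] := ubnP k; elim: j => // j IH in k *; rewrite ltnS.
case: k => [|k] kj; first by rewrite a0.
rewrite aS; apply: sumr_ge0 => l _; rewrite mulrn_wge0// mulr_ge0// IH//.
exact: leq_ltn_trans (leq_subr _ _) kj.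
Qed.

(** Normalized moments [y k = a k * r ^ k / k!] satisfy
    [k.+1 * y k.+1 <= exp r * max (y 0, ..., y k)]; the factor [k.+1] eventually
    exceeds [exp r], so they stay bounded for every [r]. *)
Lemma dickman_moments_bounded (r : R) : 0 <= r ->
  exists2 B, 0 <= B & forall k, r ^+ k / k`!%:R * a k <= B.
Proof.
move=> r0; pose y k := r ^+ k / k`!%:R * a k.
have y0 k : 0 <= y k by rewrite mulr_ge0// divr_ge0// exprn_ge0.
pose e l := r ^+ l.+1 / (l.+1)`!%:R.
have e0 l : 0 <= e l by rewrite divr_ge0// exprn_ge0.
have [_ aS] := a_rec.
have yS k : k.+1%:R * y k.+1 = \sum_(l < k.+1) y (k - l)%N * e l.
  rewrite /y aS !mulr_sumr; apply: eq_bigr => l _.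
  have lk : (l <= k)%N by rewrite -ltnS.
  have -> : r ^+ k.+1 = r ^+ (k - l) * r ^+ l.+1 by rewrite -exprD addnS subnK.
  rewrite -[a _ * _ *+ _]mulr_natr /e !factS !natrM.
  have H : 'C(k, l)%:R * (l`!%:R * (k - l)`!%:R) = k`!%:R :> R.
    by rewrite -!natrM bin_fact.
  have n0 j : j.+1%:R != 0 :> R by rewrite pnatr_eq0.
  have f0 j : j`!%:R != 0 :> R by rewrite pnatr_eq0 -lt0n fact_gt0.
  rewrite -H; have := f0 l; have := f0 (k - l)%N; have := n0 k; have := n0 l.
  have : 'C(k, l)%:R != 0 :> R by rewrite pnatr_eq0 -lt0n bin_gt0.
  move: ('C(k, l)%:R) (l.+1%:R) (k.+1%:R) ((k - l)`!%:R) (l`!%:R) => u1 u2 u3 u4 u5 *.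
  by field; apply/and5P.
have sumE m : \sum_(l < m) e l <= expR r.
  rewrite /expR; apply: le_trans (nondecreasing_cvgn_le _ (is_cvg_series_exp_coeff r) m.+1).
    rewrite /series/= big_mkord big_ord_recl/= -[leLHS]add0r; apply: lerD.
      exact: exp_coeff_ge0.
    exact: ler_sum.
  by apply/nondecreasing_seqP => k; rewrite !seriesEnat/= big_nat_recr//= lerDl exp_coeff_ge0.
pose K := (Num.trunc (expR r)).+1.
have KE : expR r <= K%:R by rewrite ltW// truncnS_gt.
pose B := \sum_(j < K.+1) y j.
exists B => [|k]; first exact: sumr_ge0.
rewrite -/(y k); have [j] := ubnP k; elim: j => // j IH in k *; rewrite ltnS => kj.
have [kK|Kk] := leqP k K.
  by rewrite /B (bigD1 (Ordinal (kK : (k < K.+1)%N)))//= lerDl sumr_ge0.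
case: k => // k in kj Kk *.
have k0 : 0 < k.+1%:R :> R by rewrite ltr0n.
rewrite -(ler_pM2l k0) yS.
apply: (@le_trans _ _ (B * \sum_(l < k.+1) e l)).
  rewrite mulr_sumr; apply: ler_sum => l _; rewrite ler_wpM2r//.
  by apply: IH; exact: leq_ltn_trans (leq_subr _ _) kj.
rewrite mulrC ler_wpM2r//; first exact: sumr_ge0.
apply: le_trans (sumE _) (le_trans KE _).
by rewrite ler_nat ltnW.
Qed.

(** Boundedness with [2 * s] in place of [s] leaves a factor [2 ^- k]. *)
Lemma dickman_moments_small (s : R) : 0 <= s ->
  s ^+ k / k`!%:R * a k @[k --> \oo] --> (0 : R).
Proof.
move=> s0; have r0 : 0 <= 2 * s by rewrite mulr_ge0.
have [B B0 hB] := dickman_moments_bounded r0.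
apply: (@squeeze_cvgr _ _ _ _ (cst 0) (fun k => B * 2^-1 ^+ k)).
- apply: nearW => k; rewrite mulr_ge0 ?divr_ge0 ?exprn_ge0//=.
  rewrite exprVn ler_pdivlMr ?exprn_gt0//.
  by apply: le_trans (hB k); rewrite exprMn mulrC !mulrA.
- exact: cvg_cst.
- rewrite -[X in _ --> X](mulr0 B); apply: cvgn_mul; first exact: cvg_cst.
  by apply: cvg_expr; rewrite ger0_norm// invf_lt1// ltr1n.
Qed.

End dickman_moment_growth.

(** * The natural probabilities and their limit *)

Section supports.

Lemma prime_extensible_Omega N : prime_extensible N (Omega N).
Proof.
split.
- by move=> n [].
- move=> n d [n0 h] dn; split; first exact: dvdn_gt0 dn.
  by move=> j Nj; apply: contra (h j Nj) => /dvdn_trans; exact.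
- move=> i m iN [m0 h] _; split; first by rewrite muln_gt0 m0 prime_gt0// nth_prime_prime.
  move=> j Nj; rewrite Euclid_dvdM ?nth_prime_prime ?(leq_ltn_trans _ Nj)//.
  rewrite negb_or h// andbT dvdn_prime2 ?nth_prime_prime ?(leq_ltn_trans _ Nj)//.
  by apply/eqP => /nth_prime_inj ji; move: Nj; rewrite ji ltnS leqNgt iN.
- move=> n q [n0 h] qp qn; have [[//|j] _ qE] := nth_prime_surj qp.
  exists j => //; rewrite ltnNge; apply/negP => Nj.
  by have := h j.+1 Nj; rewrite qE qn.
Qed.

(** Adding a prime that does not divide [m] gives it exponent [1 < k]. *)
Lemma prime_extensible_kfree N k : (2 <= k)%N ->
  prime_extensible N (Omega N `&` kfree k).
Proof.
move=> k2; have [T0 Td Tp Tq] := prime_extensible_Omega N; split.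
- by move=> n [/T0].
- move=> n d [nO [n0 h]] dn; split; first exact: Td dn.
  split; first exact: dvdn_gt0 dn.
  by move=> q qp; apply: contra (h q qp) => /dvdn_trans; exact.
- move=> i m iN [mO [m0 h]] pm; split; first exact: Tp.
  split; first by rewrite muln_gt0 m0 prime_gt0// nth_prime_prime.
  move=> q qp; set p := nth_prime i.+1; have pp : prime p by exact: nth_prime_prime.
  have [->|qp'] := eqVneq q p.
    rewrite -(subnK k2) addn2 expnS dvdn_pmul2l ?prime_gt0//.
    by apply: contra pm => /(dvdn_trans _); apply; rewrite expnS dvdn_mulr.
  rewrite Gauss_dvdr ?h// coprime_pexpl ?(leq_trans _ k2)//.
  by rewrite prime_coprime// dvdn_prime2.
- by move=> n q [nO _]; exact: Tq nO.
Qed.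

Variable R : realType.

Lemma P_harmonic_weight N n :
  P_ R N [set n] = (harmonic_weight (Omega N) (C_ R N)^-1 n)%:E.
Proof. by rewrite /P_ esum_set1 ?lee_fin ?P_pmf_ge0. Qed.

Lemma Pk_harmonic_weight k N n : (0 < k)%N ->
  Pk_ R k N [set n] = (harmonic_weight (Omega N `&` kfree k)
    ((C_ R N)^-1 * (fine (P_ R N (kfree k)))^-1) n)%:E.
Proof.
move=> k0; rewrite Pk_E// /harmonic_weight; have [kn|kn] := pselect (kfree k n).
  rewrite (_ : [set n] `&` kfree k = [set n]); last first.
    by apply/seteqP; split=> x /=; [case | move=> ->].
  rewrite P_harmonic_weight -EFinM /harmonic_weight in_setI (mem_set kn) andbT.
  by case: ifP => _; rewrite ?mul0r// mulrAC.
rewrite (_ : [set n] `&` kfree k = set0); last first.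
  by apply/seteqP; split=> x //= [->].
by rewrite measure0 mul0e in_setI (memNset kn) andbF.
Qed.

Lemma log_ratio_ge0 N n : 0 <= log_ratio R N n.
Proof.
have ln_nat_ge0 m : 0 <= ln m%:R :> R.
  by case: m => [|m]; [rewrite ln0 | rewrite ln_ge0// ler1n].
exact: divr_ge0.
Qed.

End supports.

Section assembly.
Variables (R : realType) (D : probability R R).
Hypothesis hD : dickman_distribution D.

Lemma dickman_distribution_neg : D [set x : R | x < 0] = 0%E.
Proof.
have [rho _ ->] := hD.
  rewrite (_ : _ `&` _ = set0) ?integral_set0//.
  apply/seteqP; split=> x //= [x0]; rewrite in_itv/= andbT => /(lt_trans x0).
  by rewrite ltxx.
by rewrite -set_itvNyo; exact: measurable_itv.
Qed.

Lemma weak_cvg_dickman (T : nat -> set nat) (c : nat -> R)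
    (Q : nat -> probability nat R) :
  (forall N, 0 <= c N) -> (forall N, prime_extensible N (T N)) ->
  (forall N n, Q N [set n] = (harmonic_weight (T N) (c N) n)%:E) ->
  weak_cvg (fun N => distribution (Q N) (log_ratio R N)) D.
Proof.
move=> c0 Text QE; have [a a_rec aE] := dickman_distribution_moments hD.
apply: (weak_cvg_of_moments (N0 := 1)
  (b_ := fun N k => moment N (T N) (c N) k) (b := a)) => //.
- move=> N; transitivity (Q N (log_ratio R N @^-1` [set x : R | x < 0])) => //.
  rewrite (_ : _ @^-1` _ = set0); first exact: measure0.
  by apply/seteqP; split=> n //=; rewrite ltNge log_ratio_ge0.
- exact: dickman_distribution_neg.
- by move=> N k N1; exact: integral_log_ratio_moment.
- by move=> k; exact: (moment_cvg c0 Text QE).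
- by move=> s s0; exact: dickman_moments_small.
Qed.

End assembly.

Theorem theorem1 (R : realType) (D : probability R R)
    (hD : dickman_distribution D) :
  weak_cvg (fun N => distribution (P_ R N) (log_ratio R N)) D /\
  forall k : nat, (2 <= k)%N ->
    weak_cvg (fun N => distribution (Pk_ R k N) (log_ratio R N)) D.
Proof.
split=> [|k k2].
  apply: (weak_cvg_dickman hD _ prime_extensible_Omega (P_harmonic_weight R)) => N.
  by rewrite invr_ge0 ltW// C_gt0.
have k0 : (0 < k)%N by exact: ltnW.
apply: (weak_cvg_dickman hD _ (fun N => prime_extensible_kfree N k2)
  (fun N n => Pk_harmonic_weight R N n k0)) => N.
apply: mulr_ge0; rewrite invr_ge0; first by rewrite ltW// C_gt0.
by rewrite fine_ge0.
Qed.
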